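(* Let $(\mathcal{A},\mathbb{C})$ be a strongly deflation-exact category in which every morphism has a kernel. Then the left heart of $(\mathcal{A},\mathbb{C})$ admits the description $$\mathcal{LH}(\mathcal{A},\mathbb{C})\cong \mathrm{hMor}_{\ker}(\mathcal{A})[\mathcal{S}_{\mathbb{C}}^{-1}]$$ (equivalence of categories), where: (i) The objects of $\mathrm{hMor}_{\ker}(\mathcal{A})$ are sequences $X_f:=(\ker f\xrightarrow{k_f}X'\xrightarrow{f}X)$ in $\mathcal{A}$, where $f$ is any morphism of $\mathcal{A}$ and $k_f$ is its kernel. (ii) A morphism $\alpha=(\alpha'',\alpha',\alpha)\colon X_f\to Y_g$ in $\mathrm{hMor}_{\ker}(\mathcal{A})$ consists of morphisms $\alpha''\colon\ker f\to\ker g$, $\alpha'\colon X'\to Y'$, $\alpha\colon X\to Y$ with $k_g\alpha''=\alpha'k_f$ and $g\alpha'=\alpha f$, modulo the equivalence relation $\alpha\sim\beta$ iff there exists $\rho\colon X\to Y'$ with $\alpha-\beta=g\rho$ (an equation between the components $X\to Y$). (iii) The class $\mathcal{S}_{\mathbb{C}}$ consists of all morphisms $\alpha\colon X_f\to Y_g$ for which the sequence $$\mathrm{cone}(\alpha):=\Bigl(\ker f\xrightarrow{\left[\begin{smallmatrix}-k_f\\ \alpha''\end{smallmatrix}\right]}X'\oplus\ker g\xrightarrow{\left[\begin{smallmatrix}-f&0\\ \alpha'&k_g\end{smallmatrix}\right]}X\oplus Y'\xrightarrow{[\alpha\ g]}Y\Bigr)$$ has the following property: writing $k_{[\alpha\,g]}\colon\ker[\alpha\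 g]\to X\oplus Y'$ for the kernel of $[\alpha\ g]$ and factoring the middle map as $k_{[\alpha\,g]}\,r$ with $r\colon X'\oplus\ker g\to\ker[\alpha\ g]$, both pairs $\bigl(\left[\begin{smallmatrix}-k_f\\ \alpha''\end{smallmatrix}\right],r\bigr)$ and $\bigl(k_{[\alpha\,g]},[\alpha\ g]\bigr)$ belong to $\mathbb{C}$. (iv) The class $\mathcal{S}_{\mathbb{C}}$ is a saturated multiplicative system in $\mathrm{hMor}_{\ker}(\mathcal{A})$; that is, the morphisms of $\mathrm{hMor}_{\ker}(\mathcal{A})[\mathcal{S}_{\mathbb{C}}^{-1}]$ can be represented as left fractions $\sigma^{-1}\alpha\equiv(X_f\xrightarrow{\alpha}Z_h\xleftarrow{\sigma}Y_g)$ or as right fractions $\alpha\sigma^{-1}\equiv(X_f\xleftarrow{\sigma}Z_h\xrightarrow{\alpha}Y_g)$ with $\sigma\in\mathcal{S}_{\mathbb{C}}$, with the usual calculus of fractions.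
   Context: Conflation categories. A conflation category $(\mathcal{A},\mathbb{C})$ is an additive category $\mathcal{A}$ with a class $\mathbb{C}$, closed under isomorphisms, of kernel-cokernel pairs $(f,g)$ (i.e. $f=\ker g$ and $g=\operatorname{cok}f$), called conflations; $f$ is then called an inflation and $g$ a deflation. It is deflation-exact if (R0) every $X\to 0$ is a deflation, (R1) deflations are closed under composition, (R2) the pullback of a deflation along any morphism exists and is a deflation. It is strongly deflation-exact if moreover (R3): if $p$ has a kernel and $pi$ is a deflation for some $i$, then $p$ is a deflation. No existence of cokernels and no admissibility of kernels is assumed. Derived category. $\mathsf{K}(\mathcal{A})$ is the homotopy category of cochain complexes. A complex $(C^n,d^n)$ is $\mathbb{C}$-acyclic if every differential factors as $d^{n}=i^{n}p^{n}$, with $p^{n}\colon C^n\to Z^{n+1}$, $i^{n}\colon Z^{n+1}\to C^{n+1}$, such that $(i^{n-2},p^{n-1})\in\mathbb{C}$ for all $n$ (then $i^{n-1}=\ker d^n$). The $\mathbb{C}$-acyclic complexes form a thick triangulated subcategory $\mathsf{Ac}(\mathcal{A},\mathbb{C})\subseteq\mathsf{K}(\mathcal{A})$, and $\mathsf{D}(\mathcal{A},\mathbb{C}):=\mathsf{K}(\mathcal{A})/\mathsf{Ac}(\mathcal{A},\mathbb{C})$ (Verdier quotient); $\mathsf{D}^{\mathsf b}(\mathcal{A},\mathbb{C})$ is defined analogously from bounded complexes. Left heart. For a complex $C^\bullet$ let $i^{n-1}\colon\ker d^n\to C^n$ be the kernel of $d^n$ and $p^{n-1}\colon C^{n-1}\to\ker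 d^n$ the map with $i^{n-1}p^{n-1}=d^{n-1}$. Set $\mathsf{D}_{\rm L}^{\leqslant0}=\{C^\bullet\mid\forall n\geqslant1\colon(\ker d^{n-1}\xrightarrow{i^{n-2}}C^{n-1}\xrightarrow{p^{n-1}}\ker d^n)\in\mathbb{C}\}$ and $\mathsf{D}_{\rm L}^{\geqslant0}=\{C^\bullet\mid\forall n\leqslant-1\colon(\ker d^{n-1}\to C^{n-1}\to\ker d^n)\in\mathbb{C}\}$, full subcategories of $\mathsf{D}(\mathcal{A},\mathbb{C})$. They form a t-structure; its heart $\mathcal{LH}(\mathcal{A},\mathbb{C})=\mathsf{D}_{\rm L}^{\leqslant0}\cap\mathsf{D}_{\rm L}^{\geqslant0}$ is the left heart. Multiplicative system: a class of morphisms containing identities and closed under composition, satisfying the Ore condition and the cancellation condition on both sides. Saturated: $fg,gh\in\mathcal{S}$ implies $g\in\mathcal{S}$ (equivalently, $\mathcal{S}$ consists exactly of the morphisms that become invertible in the localization). Size convention: it is assumed that $\mathsf{D}^{\mathsf b}(\mathcal{A},\mathbb{C})$ is locally small (so that all localizations are well-defined). *)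

(* Defs.v *)
From mathcomp Require Import all_boot all_order all_algebra.

Set Implicit Arguments.
Unset Strict Implicit.
Unset Printing Implicit Defensive.

Import GRing.Theory.
Local Open Scope ring_scope.

(* Categories have hom-setoids: [X ~> Y] carries an equivalence relation [==~]
   playing the role of equality of morphisms, so that quotients of hom-sets
   (homotopy classes, localizations) only change that relation. *)

Record category := Category {
  cob :> Type;
  chom : cob -> cob -> Type;
  ceq : forall X Y, chom X Y -> chom X Y -> Prop;
  cid : forall X, chom X X;
  ccomp : forall X Y Z, chom Y Z -> chom X Y -> chom X Z;
  ceq_refl : forall X Y (f : chom X Y), ceq f f;
  ceq_sym : forall X Y (f g : chom X Y), ceq f g -> ceq g f;
  ceq_trans : forall X Y (f g h : chom X Y), ceq f g -> ceq g h -> ceq f h;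
  ccomp_eq : forall X Y Z (g g' : chom Y Z) (f f' : chom X Y),
    ceq g g' -> ceq f f' -> ceq (ccomp g f) (ccomp g' f');
  ccomp1l : forall X Y (f : chom X Y), ceq (ccomp (cid Y) f) f;
  ccomp1r : forall X Y (f : chom X Y), ceq (ccomp f (cid X)) f;
  ccompA : forall X Y Z W (h : chom Z W) (g : chom Y Z) (f : chom X Y),
    ceq (ccomp h (ccomp g f)) (ccomp (ccomp h g) f)
}.

Arguments chom {c} X Y.
Arguments ceq {c X Y} f g.
Arguments cid {c} X.
Arguments ccomp {c X Y Z} g f.

Notation "X ~> Y" := (chom X Y) (at level 90, right associativity).
Notation "f ==~ g" := (ceq f g) (at level 70, no associativity).
Notation "g \c f" := (ccomp g f) (at level 40, left associativity).

Record functor (C D : category) := Functor {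
  fob :> C -> D;
  fmap : forall X Y : C, (X ~> Y) -> (fob X ~> fob Y);
  fmap_eq : forall X Y (f g : X ~> Y), f ==~ g -> fmap f ==~ fmap g;
  fmap1 : forall X : C, fmap (cid X) ==~ cid (fob X);
  fmapM : forall X Y Z (g : Y ~> Z) (f : X ~> Y),
    fmap (g \c f) ==~ fmap g \c fmap f
}.

Definition equivalence_of_categories (C D : category) : Prop :=
  exists (F : functor C D) (G : functor D C)
    (eta : forall X : C, X ~> G (F X)) (eta' : forall X : C, G (F X) ~> X)
    (eps : forall Y : D, F (G Y) ~> Y) (eps' : forall Y : D, Y ~> F (G Y)),
    [/\ forall X X' (f : X ~> X'),
          fmap G (fmap F f) \c eta X ==~ eta X' \c f,
        forall Y Y' (g : Y ~> Y'),
          g \c eps Y ==~ eps Y' \c fmap F (fmap G g),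
        forall X, eta' X \c eta X ==~ cid X /\ eta X \c eta' X ==~ cid _
      & forall Y, eps' Y \c eps Y ==~ cid _ /\ eps Y \c eps' Y ==~ cid Y].

Definition full_subcategory (C : category) (P : C -> Prop) : category :=
  @Category {X : C | P X}
    (fun X Y => sval X ~> sval Y)
    (fun X Y f g => f ==~ g)
    (fun X => cid (sval X))
    (fun X Y Z g f => g \c f)
    (fun X Y => @ceq_refl C _ _)
    (fun X Y => @ceq_sym C _ _)
    (fun X Y => @ceq_trans C _ _)
    (fun X Y Z => @ccomp_eq C _ _ _)
    (fun X Y => @ccomp1l C _ _)
    (fun X Y => @ccomp1r C _ _)
    (fun X Y Z W => @ccompA C _ _ _ _).

(* Localization (Gabriel-Zisman): morphisms of [localization S] are formal
   composites of morphisms of C and of inverses of morphisms in S; their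
   equality is the least congruence making C -> C[S^-1] a functor and each
   [loc_inv] a two-sided inverse. *)

Definition mor_class (C : category) := forall X Y : C, (X ~> Y) -> Prop.

Section Localization.
Context (C : category) (S : mor_class C).

Inductive loc_hom : C -> C -> Type :=
| loc_mor X Y (f : X ~> Y) : loc_hom X Y
| loc_inv X Y (s : X ~> Y) (Ss : S s) : loc_hom Y X
| loc_comp X Y Z (g : loc_hom Y Z) (f : loc_hom X Y) : loc_hom X Z.

Inductive loc_eq : forall X Y, loc_hom X Y -> loc_hom X Y -> Prop :=
| loc_refl X Y (f : loc_hom X Y) : loc_eq f f
| loc_sym X Y (f g : loc_hom X Y) : loc_eq f g -> loc_eq g f
| loc_trans X Y (f g h : loc_hom X Y) : loc_eq f g -> loc_eq g h -> loc_eq f h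
| loc_comp_eq X Y Z (g g' : loc_hom Y Z) (f f' : loc_hom X Y) :
    loc_eq g g' -> loc_eq f f' -> loc_eq (loc_comp g f) (loc_comp g' f')
| loc_1l X Y (f : loc_hom X Y) : loc_eq (loc_comp (loc_mor (cid Y)) f) f
| loc_1r X Y (f : loc_hom X Y) : loc_eq (loc_comp f (loc_mor (cid X))) f
| loc_A X Y Z W (h : loc_hom Z W) (g : loc_hom Y Z) (f : loc_hom X Y) :
    loc_eq (loc_comp h (loc_comp g f)) (loc_comp (loc_comp h g) f)
| loc_mor_eq X Y (f g : X ~> Y) : f ==~ g -> loc_eq (loc_mor f) (loc_mor g)
| loc_mor_comp X Y Z (g : Y ~> Z) (f : X ~> Y) :
    loc_eq (loc_mor (g \c f)) (loc_comp (loc_mor g) (loc_mor f))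
| loc_invl X Y (s : X ~> Y) (Ss : S s) :
    loc_eq (loc_comp (loc_inv Ss) (loc_mor s)) (loc_mor (cid X))
| loc_invr X Y (s : X ~> Y) (Ss : S s) :
    loc_eq (loc_comp (loc_mor s) (loc_inv Ss)) (loc_mor (cid Y)).

Definition localization : category :=
  @Category C loc_hom loc_eq (fun X => loc_mor (cid X)) loc_comp
    loc_refl loc_sym loc_trans loc_comp_eq loc_1l loc_1r loc_A.

(* [respects_eq]: membership in S only depends on the morphism, i.e. on the
   class of a representative modulo [==~]. *)
Record multiplicative_system : Prop := MultiplicativeSystem {
  ms_respects_eq : forall X Y (s t : X ~> Y), s ==~ t -> S s -> S t;
  ms_id : forall X : C, S (cid X);
  ms_comp : forall X Y Z (t : Y ~> Z) (s : X ~> Y), S t -> S s -> S (t \c s);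
  ms_ore_left : forall X X' Y (f : X ~> Y) (s : X ~> X'), S s ->
    exists Y' (f' : X' ~> Y') (s' : Y ~> Y'), S s' /\ s' \c f ==~ f' \c s;
  ms_ore_right : forall X Y Y' (f : X ~> Y) (s : Y' ~> Y), S s ->
    exists X' (f' : X' ~> Y') (s' : X' ~> X), S s' /\ f \c s' ==~ s \c f';
  ms_cancel_left : forall X X' Y (f g : X ~> Y) (s : X' ~> X), S s ->
    f \c s ==~ g \c s -> exists Y' (t : Y ~> Y'), S t /\ t \c f ==~ t \c g;
  ms_cancel_right : forall X Y Y' (f g : X ~> Y) (t : Y ~> Y'), S t ->
    t \c f ==~ t \c g -> exists X' (s : X' ~> X), S s /\ f \c s ==~ g \c s
}.

Definition saturated : Prop :=
  forall X Y Z W (f : Z ~> W) (g : Y ~> Z) (h : X ~> Y),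
    S (f \c g) -> S (g \c h) -> S g.

Definition left_fraction X Y Z (s : Y ~> Z) (Ss : S s) (a : X ~> Z) :
  loc_hom X Y := loc_comp (loc_inv Ss) (loc_mor a).

Definition right_fraction X Y Z (a : Z ~> Y) (s : Z ~> X) (Ss : S s) :
  loc_hom X Y := loc_comp (loc_mor a) (loc_inv Ss).

(* The rule for composing fractions takes as input any Ore square
   exchanging the inner numerator and denominator. *)
Record calculus_of_left_fractions : Prop := CalculusOfLeftFractions {
  clf_repr : forall X Y (phi : loc_hom X Y),
    exists Z (a : X ~> Z) (s : Y ~> Z) (Ss : S s),
      loc_eq phi (left_fraction Ss a);
  clf_eq : forall X Y Z1 Z2 (a1 : X ~> Z1) (s1 : Y ~> Z1) (Ss1 : S s1)
                  (a2 : X ~> Z2) (s2 : Y ~> Z2) (Ss2 : S s2),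
    loc_eq (left_fraction Ss1 a1) (left_fraction Ss2 a2) <->
    exists W (u1 : Z1 ~> W) (u2 : Z2 ~> W),
      [/\ u1 \c a1 ==~ u2 \c a2, u1 \c s1 ==~ u2 \c s2 & S (u1 \c s1)];
  clf_comp : forall X Y V Z W U (a : X ~> Z) (s : Y ~> Z) (Ss : S s)
                  (b : Y ~> W) (t : V ~> W) (St : S t)
                  (c : Z ~> U) (r : W ~> U) (Srt : S (r \c t)),
    S r -> r \c b ==~ c \c s ->
    loc_eq (loc_comp (left_fraction St b) (left_fraction Ss a))
           (left_fraction Srt (c \c a))
}.

Record calculus_of_right_fractions : Prop := CalculusOfRightFractions {
  crf_repr : forall X Y (phi : loc_hom X Y),
    exists Z (a : Z ~> Y) (s : Z ~> X) (Ss : S s),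
      loc_eq phi (right_fraction a Ss);
  crf_eq : forall X Y Z1 Z2 (a1 : Z1 ~> Y) (s1 : Z1 ~> X) (Ss1 : S s1)
                  (a2 : Z2 ~> Y) (s2 : Z2 ~> X) (Ss2 : S s2),
    loc_eq (right_fraction a1 Ss1) (right_fraction a2 Ss2) <->
    exists W (u1 : W ~> Z1) (u2 : W ~> Z2),
      [/\ a1 \c u1 ==~ a2 \c u2, s1 \c u1 ==~ s2 \c u2 & S (s1 \c u1)];
  crf_comp : forall X Y V Z W U (a : Z ~> Y) (s : Z ~> X) (Ss : S s)
                  (b : W ~> V) (t : W ~> Y) (St : S t)
                  (c : U ~> W) (r : U ~> Z) (Ssr : S (s \c r)),
    S r -> a \c r ==~ t \c c ->
    loc_eq (loc_comp (right_fraction b St) (right_fraction a Ss))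
           (right_fraction (b \c c) Ssr)
}.

End Localization.

Record additive_category := AdditiveCategory {
  aob :> Type;
  ahom : aob -> aob -> zmodType;
  aid : forall X, ahom X X;
  acomp : forall X Y Z, ahom Y Z -> ahom X Y -> ahom X Z;
  acomp1l : forall X Y (f : ahom X Y), acomp (aid Y) f = f;
  acomp1r : forall X Y (f : ahom X Y), acomp f (aid X) = f;
  acompA : forall X Y Z W (h : ahom Z W) (g : ahom Y Z) (f : ahom X Y),
    acomp h (acomp g f) = acomp (acomp h g) f;
  acompDl : forall X Y Z (g g' : ahom Y Z) (f : ahom X Y),
    acomp (g + g') f = acomp g f + acomp g' f;
  acompDr : forall X Y Z (g : ahom Y Z) (f f' : ahom X Y),
    acomp g (f + f') = acomp g f + acomp g f';
  azero : aob;
  azeroP : aid azero = 0;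
  abip : aob -> aob -> aob;
  ain1 : forall X Y, ahom X (abip X Y);
  ain2 : forall X Y, ahom Y (abip X Y);
  apr1 : forall X Y, ahom (abip X Y) X;
  apr2 : forall X Y, ahom (abip X Y) Y;
  apr1_in1 : forall X Y, acomp (apr1 X Y) (ain1 X Y) = aid X;
  apr2_in2 : forall X Y, acomp (apr2 X Y) (ain2 X Y) = aid Y;
  apr1_in2 : forall X Y, acomp (apr1 X Y) (ain2 X Y) = 0;
  apr2_in1 : forall X Y, acomp (apr2 X Y) (ain1 X Y) = 0;
  abipP : forall X Y, acomp (ain1 X Y) (apr1 X Y) +
                      acomp (ain2 X Y) (apr2 X Y) = aid (abip X Y)
}.

Arguments ahom {a} X Y.
Arguments aid {a} X.
Arguments acomp {a X Y Z} g f.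
Arguments azero {a}.
Arguments abip {a} X Y.
Arguments ain1 {a X Y}.
Arguments ain2 {a X Y}.
Arguments apr1 {a X Y}.
Arguments apr2 {a X Y}.

Notation "X ⟶ Y" := (ahom X Y) (at level 90, right associativity).
Notation "g ∘ f" := (acomp g f) (at level 40, left associativity).
Notation "X ⊕ Y" := (abip X Y) (at level 50, left associativity).

Section AdditiveCategory.
Context (A : additive_category).

Lemma acomp0l (X Y Z : A) (f : X ⟶ Y) : (0 : Y ⟶ Z) ∘ f = 0.
Proof. by apply: (addrI (0 ∘ f)); rewrite -acompDl !addr0. Qed.

Lemma acomp0r (X Y Z : A) (g : Y ⟶ Z) : g ∘ (0 : X ⟶ Y) = 0.
Proof. by apply: (addrI (g ∘ 0)); rewrite -acompDr !addr0. Qed.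

Lemma acompNl (X Y Z : A) (g : Y ⟶ Z) (f : X ⟶ Y) : (- g) ∘ f = - (g ∘ f).
Proof. by apply: (addrI (g ∘ f)); rewrite -acompDl !subrr acomp0l. Qed.

Lemma acompNr (X Y Z : A) (g : Y ⟶ Z) (f : X ⟶ Y) : g ∘ (- f) = - (g ∘ f).
Proof. by apply: (addrI (g ∘ f)); rewrite -acompDr !subrr acomp0r. Qed.

Lemma acompBl (X Y Z : A) (g g' : Y ⟶ Z) (f : X ⟶ Y) :
  (g - g') ∘ f = g ∘ f - g' ∘ f.
Proof. by rewrite acompDl acompNl. Qed.

Lemma acompBr (X Y Z : A) (g : Y ⟶ Z) (f f' : X ⟶ Y) :
  g ∘ (f - f') = g ∘ f - g ∘ f'.
Proof. by rewrite acompDr acompNr. Qed.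

Definition row_mor (X Y Z : A) (a : X ⟶ Z) (b : Y ⟶ Z) : X ⊕ Y ⟶ Z :=
  a ∘ apr1 + b ∘ apr2.

Definition col_mor (X Y Z : A) (a : Z ⟶ X) (b : Z ⟶ Y) : Z ⟶ X ⊕ Y :=
  ain1 ∘ a + ain2 ∘ b.

(* The morphism with matrix [a b; c d]. *)
Definition block_mor (X Y X' Y' : A) (a : X ⟶ X') (b : Y ⟶ X')
    (c : X ⟶ Y') (d : Y ⟶ Y') : X ⊕ Y ⟶ X' ⊕ Y' :=
  col_mor (row_mor a b) (row_mor c d).

Lemma row_col (X Y Z W : A) (a : X ⟶ Z) (b : Y ⟶ Z) (c : W ⟶ X)
  (d : W ⟶ Y) : row_mor a b ∘ col_mor c d = a ∘ c + b ∘ d.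
Proof.
rewrite /row_mor /col_mor acompDr !acompDl !acompA.
rewrite -![_ ∘ apr1 ∘ _]acompA -![_ ∘ apr2 ∘ _]acompA.
by rewrite apr1_in1 apr1_in2 apr2_in1 apr2_in2 !acomp0r !acomp1r
           !acomp0l addr0 add0r.
Qed.

Lemma row_morM (X Y Z W : A) (e : Z ⟶ W) (a : X ⟶ Z) (b : Y ⟶ Z) :
  e ∘ row_mor a b = row_mor (e ∘ a) (e ∘ b).
Proof. by rewrite /row_mor acompDr !acompA. Qed.

Lemma col_morM (X Y Z W : A) (e : W ⟶ Z) (a : Z ⟶ X) (b : Z ⟶ Y) :
  col_mor a b ∘ e = col_mor (a ∘ e) (b ∘ e).
Proof. by rewrite /col_mor acompDl -!acompA. Qed.

Lemma row_morD (X Y Z : A) (a a' : X ⟶ Z) (b b' : Y ⟶ Z) :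
  row_mor a b + row_mor a' b' = row_mor (a + a') (b + b').
Proof. by rewrite /row_mor !acompDl addrACA. Qed.

Definition is_iso (X Y : A) (f : X ⟶ Y) : Prop :=
  exists g : Y ⟶ X, g ∘ f = aid X /\ f ∘ g = aid Y.

Definition is_kernel (K X Y : A) (k : K ⟶ X) (f : X ⟶ Y) : Prop :=
  f ∘ k = 0 /\
  forall T (t : T ⟶ X), f ∘ t = 0 -> exists! u : T ⟶ K, k ∘ u = t.

Definition is_cokernel (X Y Q : A) (q : Y ⟶ Q) (f : X ⟶ Y) : Prop :=
  q ∘ f = 0 /\
  forall T (t : Y ⟶ T), t ∘ f = 0 -> exists! u : Q ⟶ T, u ∘ q = t.

(*  P --f'-> Y
    |p'       |p
    W --f ⟶ Z  *)
Definition is_pullback (P Y W Z : A) (f' : P ⟶ Y) (p' : P ⟶ W)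
    (p : Y ⟶ Z) (f : W ⟶ Z) : Prop :=
  p ∘ f' = f ∘ p' /\
  forall T (y : T ⟶ Y) (w : T ⟶ W), p ∘ y = f ∘ w ->
    exists! u : T ⟶ P, f' ∘ u = y /\ p' ∘ u = w.

Definition has_kernels : Prop :=
  forall (X Y : A) (f : X ⟶ Y), exists (K : A) (k : K ⟶ X), is_kernel k f.

Definition pair_class := forall X Y Z : A, (X ⟶ Y) -> (Y ⟶ Z) -> Prop.

Record conflation_structure (CC : pair_class) : Prop := ConflationStructure {
  confl_ker : forall X Y Z (f : X ⟶ Y) (g : Y ⟶ Z), CC _ _ _ f g ->
    is_kernel f g;
  confl_cok : forall X Y Z (f : X ⟶ Y) (g : Y ⟶ Z), CC _ _ _ f g ->
    is_cokernel g f;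
  confl_iso : forall X Y Z X' Y' Z' (f : X ⟶ Y) (g : Y ⟶ Z)
      (f' : X' ⟶ Y') (g' : Y' ⟶ Z')
      (a : X ⟶ X') (b : Y ⟶ Y') (c : Z ⟶ Z'),
    is_iso a -> is_iso b -> is_iso c ->
    f' ∘ a = b ∘ f -> g' ∘ b = c ∘ g -> CC _ _ _ f g -> CC _ _ _ f' g'
}.

Definition deflation (CC : pair_class) (Y Z : A) (g : Y ⟶ Z) : Prop :=
  exists (X : A) (f : X ⟶ Y), CC X Y Z f g.

Record strongly_deflation_exact (CC : pair_class) : Prop :=
    StronglyDeflationExact {
  sde_conflation : conflation_structure CC;
  sde_R0 : forall X : A, deflation CC (0 : X ⟶ azero);
  sde_R1 : forall (X Y Z : A) (q : Y ⟶ Z) (p : X ⟶ Y),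
    deflation CC q -> deflation CC p -> deflation CC (q ∘ p);
  sde_R2 : forall (Y W Z : A) (p : Y ⟶ Z) (f : W ⟶ Z), deflation CC p ->
    exists (P : A) (f' : P ⟶ Y) (p' : P ⟶ W),
      is_pullback f' p' p f /\ deflation CC p';
  sde_R3 : forall (X Y Z : A) (p : Y ⟶ Z) (i : X ⟶ Y),
    (exists (K : A) (k : K ⟶ Y), is_kernel k p) ->
    deflation CC (p ∘ i) -> deflation CC p
}.

Record complex := Complex {
  cx :> int -> A;
  cxd : forall n : int, cx n ⟶ cx (n + 1);
  cxdd : forall n : int, cxd (n + 1) ∘ cxd n = 0
}.

Record cochain_map (X Y : complex) := CochainMap {
  cm :> forall n : int, X n ⟶ Y n;
  cmd : forall n : int, cxd Y n ∘ cm n = cm (n + 1) ∘ cxd X n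
}.

(* All degrees are of the form n + 1; this indexing avoids transports. *)
Definition homotopic (X Y : complex) (f g : cochain_map X Y) : Prop :=
  exists h : forall n : int, X (n + 1) ⟶ Y n, forall n : int,
    f (n + 1) - g (n + 1) = cxd Y n ∘ h n + h (n + 1) ∘ cxd X (n + 1).

Program Definition cochain_id (X : complex) : cochain_map X X :=
  CochainMap (cm := fun n => aid (X n)) _.
Next Obligation. by move=> * /=; rewrite acomp1l acomp1r. Qed.

Program Definition cochain_comp (X Y Z : complex) (g : cochain_map Y Z)
    (f : cochain_map X Y) : cochain_map X Z :=
  CochainMap (cm := fun n => g n ∘ f n) _.
Next Obligation. by move=> * /=; rewrite acompA cmd -acompA cmd acompA. Qed.

Lemma eq_homotopic (X Y : complex) (f g : cochain_map X Y) :
  (forall n, f n = g n) -> homotopic f g.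
Proof.
by move=> efg; exists (fun=> 0) => n; rewrite efg subrr acomp0r acomp0l addr0.
Qed.

Program Definition homotopy_category : category :=
  @Category complex cochain_map homotopic cochain_id cochain_comp
    _ _ _ _ _ _ _.
Next Obligation. by move=> *; exact: eq_homotopic. Qed.
Next Obligation.
move=> X Y f g [h hP]; exists (fun n => - h n) => n.
by rewrite acompNr acompNl -opprD -hP opprB.
Qed.
Next Obligation.
move=> X Y f g f' [h1 h1P] [h2 h2P]; exists (fun n => h1 n + h2 n) => n.
by rewrite acompDr acompDl addrACA -h1P -h2P addrA subrK.
Qed.
Next Obligation.
move=> X Y Z g g' f f' [h hP] [k kP].
exists (fun n => h n ∘ f (n + 1) + g' n ∘ k n) => n /=.
rewrite acompDr acompDl addrACA -[_ ∘ f (n + 1 + 1) ∘ _]acompA.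
rewrite -(cmd f (n + 1)) [cxd Z n ∘ (g' n ∘ _)]acompA (cmd g' n) !acompA.
rewrite -acompDl -hP.
by rewrite -!acompA -acompDr -kP acompBl acompBr addrA subrK.
Qed.
Next Obligation. by move=> *; apply: eq_homotopic => n /=; rewrite acomp1l. Qed.
Next Obligation. by move=> *; apply: eq_homotopic => n /=; rewrite acomp1r. Qed.
Next Obligation. by move=> *; apply: eq_homotopic => n /=; rewrite acompA. Qed.

Program Definition mapping_cone (X Y : complex) (f : cochain_map X Y) :
    complex :=
  @Complex (fun n : int => X (n + 1) ⊕ Y n)
    (fun n : int => block_mor (- cxd X (n + 1)) 0 (f (n + 1)) (cxd Y n)) _.
Next Obligation.
move=> X Y f n /=; rewrite /block_mor col_morM !row_col !row_morM !row_morD.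
rewrite !acomp0r !acomp0l !acompNr !acompNl !cxdd !cmd oppr0.
rewrite !oppr0 !addr0 addNr /col_mor /row_mor !acomp0l addr0.
by rewrite addr0 !acomp0r addr0.
Qed.

Section DerivedCategory.
Context (CC : pair_class).

(* [j n] is i^(n-1) : Z^n -> C^n in the usual numbering of the factorization
   d^n = i^n p^n. *)
Definition acyclic (X : complex) : Prop :=
  exists (Z : int -> A) (j : forall n : int, Z n ⟶ X n)
         (p : forall n : int, X n ⟶ Z (n + 1)),
    (forall n : int, cxd X n = j (n + 1) ∘ p n) /\
    (forall n : int, CC (j n) (p n)).

(* Over a strongly deflation-exact category with kernels, acyclic complexes are
   closed under isomorphism in the homotopy category, so the morphisms with
   cone in Ac are those whose standard mapping cone is acyclic. *)
Definition acyclic_cone : mor_class homotopy_category :=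
  fun X Y f => acyclic (mapping_cone f).

Definition derived_category : category := localization acyclic_cone.

(* (ker d^n -> C^n -> ker d^(n+1)) is a conflation *)
Definition conflation_at (X : complex) (n : int) : Prop :=
  exists (K K' : A) (i : K ⟶ X n) (i' : K' ⟶ X (n + 1)) (p : X n ⟶ K'),
    [/\ is_kernel i (cxd X n), is_kernel i' (cxd X (n + 1)),
        i' ∘ p = cxd X n & CC i p].

Definition DL_le0 (X : derived_category) : Prop :=
  forall n : int, 1 <= n -> conflation_at X (n - 1).

Definition DL_ge0 (X : derived_category) : Prop :=
  forall n : int, n <= - 1 -> conflation_at X (n - 1).

Definition left_heart : category :=
  full_subcategory (fun X : derived_category => DL_le0 X /\ DL_ge0 X).

End DerivedCategory.

Record hmor_ob := HMorOb {
  hK : A;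
  hX' : A;
  hX : A;
  hk : hK ⟶ hX';
  hf : hX' ⟶ hX;
  hkP : is_kernel hk hf
}.

Record hmor_mor (X Y : hmor_ob) := HMorMor {
  ha'' : hK X ⟶ hK Y;
  ha' : hX' X ⟶ hX' Y;
  ha : hX X ⟶ hX Y;
  ha_k : hk Y ∘ ha'' = ha' ∘ hk X;
  ha_f : hf Y ∘ ha' = ha ∘ hf X
}.

Definition hmor_eq (X Y : hmor_ob) (a b : hmor_mor X Y) : Prop :=
  exists rho : hX X ⟶ hX' Y, ha a - ha b = hf Y ∘ rho.

Program Definition hmor_id (X : hmor_ob) : hmor_mor X X :=
  @HMorMor X X (aid _) (aid _) (aid _) _ _.
Next Obligation. by move=> * /=; rewrite acomp1l acomp1r. Qed.
Next Obligation. by move=> * /=; rewrite acomp1l acomp1r. Qed.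

Program Definition hmor_comp (X Y Z : hmor_ob) (b : hmor_mor Y Z)
    (a : hmor_mor X Y) : hmor_mor X Z :=
  @HMorMor X Z (ha'' b ∘ ha'' a) (ha' b ∘ ha' a) (ha b ∘ ha a) _ _.
Next Obligation. by move=> * /=; rewrite acompA ha_k -acompA ha_k acompA. Qed.
Next Obligation. by move=> * /=; rewrite acompA ha_f -acompA ha_f acompA. Qed.

Lemma eq_hmor (X Y : hmor_ob) (a b : hmor_mor X Y) : ha a = ha b -> hmor_eq a b.
Proof. by move=> eab; exists 0; rewrite eab subrr acomp0r. Qed.

Program Definition hMor_ker : category :=
  @Category hmor_ob hmor_mor hmor_eq hmor_id hmor_comp _ _ _ _ _ _ _.
Next Obligation. by move=> *; exact: eq_hmor. Qed.
Next Obligation.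
by move=> X Y a b [r rP]; exists (- r); rewrite acompNr -rP opprB.
Qed.
Next Obligation.
move=> X Y a b c [r rP] [s sP]; exists (r + s).
by rewrite acompDr -rP -sP addrA subrK.
Qed.
Next Obligation.
move=> X Y Z b b' a a' [r rP] [s sP].
exists (r ∘ ha a + ha' b' ∘ s) => /=.
rewrite acompDr !acompA -rP ha_f -acompA -sP acompBl acompBr.
by rewrite addrA subrK.
Qed.
Next Obligation. by move=> *; apply: eq_hmor; rewrite /= acomp1l. Qed.
Next Obligation. by move=> *; apply: eq_hmor; rewrite /= acomp1r. Qed.
Next Obligation. by move=> *; apply: eq_hmor; rewrite /= acompA. Qed.

Definition S_confl (CC : pair_class) : mor_class hMor_ker :=
  fun X Y (a : hmor_mor X Y) =>
    exists (K : A) (k : K ⟶ hX X ⊕ hX' Y) (r : hX' X ⊕ hK Y ⟶ K),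
      [/\ is_kernel k (row_mor (ha a) (hf Y)),
          k ∘ r = block_mor (- hf X) 0 (ha' a) (hk Y),
          CC _ _ _ (col_mor (- hk X) (ha'' a)) r
        & CC _ _ _ k (row_mor (ha a) (hf Y))].

End AdditiveCategory.

Arguments hMor_ker A : clear implicits.

(* Main.v *)
(** Deflations form a Grothendieck pretopology: they are stable under
    composition and pullback, and by (R3) a morphism which locally has a section
    is a deflation. Reading [X_f] as the cokernel sheaf of [f], the class
    [S_confl] consists of the morphisms which become isomorphisms of sheaves, and
    both exactness of complexes and acyclicity of mapping cones become statements
    about generalized elements that may be lifted after passing to a cover. The
    Ore and cancellation conditions are then witnessed by homotopy pushouts and
    pullbacks, saturation is formal, and equality of fractions is detected on
    sheaves.

    For the equivalence, [coh X = (ker d^-1 -> X^-1 -> ker d^0)] is defined on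
    all of K(A) and sends quasi-isomorphisms into [S_confl], while [three] places
    [X_f] in degrees -2, -1, 0. The natural maps [X <- tau X -> three (coh X)],
    with [tau] the truncation in degrees <= 0, are quasi-isomorphisms for X in the
    left heart, and the natural map [coh (three X_f) -> X_f] is in [S_confl].
    Truncation preserves quasi-isomorphisms, so the zigzag is natural for all
    morphisms of the derived category, including those whose formal composites
    leave the heart. *)
Require Import Defs.
From mathcomp Require Import all_boot all_order all_algebra.
From mathcomp Require Import zify.
From Stdlib Require Import Setoid ClassicalEpsilon.

Set Implicit Arguments.
Unset Strict Implicit.
Unset Printing Implicit Defensive.

Import GRing.Theory.
Local Open Scope ring_scope.

(** * Localization *)

#[local] Hint Resolve ceq_refl loc_refl : core.

Add Parametric Relation (C : category) (X Y : C) : (X ~> Y) (@ceq C X Y)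
  reflexivity proved by (@ceq_refl C X Y)
  symmetry proved by (@ceq_sym C X Y)
  transitivity proved by (@ceq_trans C X Y) as ceq_setoid.

Add Parametric Morphism (C : category) (X Y Z : C) : (@ccomp C X Y Z)
  with signature @ceq C Y Z ==> @ceq C X Y ==> @ceq C X Z as ccomp_mor.
Proof. by move=> *; apply: ccomp_eq. Qed.

Add Parametric Relation (C : category) (S : mor_class C) (X Y : C) :
    (loc_hom S X Y) (@loc_eq C S X Y)
  reflexivity proved by (@loc_refl C S X Y)
  symmetry proved by (@loc_sym C S X Y)
  transitivity proved by (@loc_trans C S X Y) as loc_setoid.

Add Parametric Morphism (C : category) (S : mor_class C) (X Y Z : C) :
    (@loc_comp C S X Y Z)
  with signature @loc_eq C S Y Z ==> @loc_eq C S X Y ==> @loc_eq C S X Z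
  as loc_comp_mor.
Proof. by move=> *; apply: loc_comp_eq. Qed.

Section Functors.
Context (C D E : category).

Definition id_functor : functor C C :=
  @Functor C C id (fun X Y f => f) (fun X Y f g efg => efg)
    (fun X => ceq_refl _) (fun X Y Z g f => ceq_refl _).

Definition comp_functor (G : functor D E) (F : functor C D) : functor C E :=
  @Functor C E (fun X => G (F X)) (fun X Y f => fmap G (fmap F f))
    (fun X Y f g efg => fmap_eq G (fmap_eq F efg))
    (fun X => ceq_trans (fmap_eq G (fmap1 F X)) (fmap1 G _))
    (fun X Y Z g f => ceq_trans (fmap_eq G (fmapM F g f)) (fmapM G _ _)).

End Functors.

Section LocalizationFunctors.
Context (C : category) (S : mor_class C).

Section Lift.
Context (D : category) (S' : mor_class D) (F : functor C D).
Hypothesis FS : forall X Y (s : X ~> Y), S s -> S' (fmap F s).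

Fixpoint lift_hom X Y (phi : loc_hom S X Y) : loc_hom S' (F X) (F Y) :=
  match phi with
  | loc_mor _ _ f => loc_mor S' (fmap F f)
  | loc_inv _ _ s Ss => loc_inv (FS Ss)
  | loc_comp _ _ _ g f => loc_comp (lift_hom g) (lift_hom f)
  end.

Lemma lift_hom_eq X Y (phi psi : loc_hom S X Y) :
  loc_eq phi psi -> loc_eq (lift_hom phi) (lift_hom psi).
Proof.
elim=> {X Y phi psi} /=.
- by [].
- by move=> X Y f g _ /loc_sym.
- by move=> X Y f g h _ e1 _ e2; apply: loc_trans e1 e2.
- by move=> X Y Z g g' f f' _ e1 _ e2; apply: loc_comp_eq.
- move=> X Y f; apply: loc_trans (loc_1l _).
  exact/loc_comp_eq/loc_refl/loc_mor_eq/fmap1.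
- move=> X Y f; apply: loc_trans (loc_1r _).
  exact/loc_comp_eq/loc_mor_eq/fmap1/loc_refl.
- by move=> *; apply: loc_A.
- by move=> X Y f g efg; apply/loc_mor_eq/fmap_eq.
- move=> X Y Z g f; apply: loc_trans (loc_mor_comp _ _ _).
  exact/loc_mor_eq/fmapM.
- move=> X Y s Ss; apply: loc_trans (loc_invl _) _.
  exact/loc_mor_eq/ceq_sym/fmap1.
- move=> X Y s Ss; apply: loc_trans (loc_invr _) _.
  exact/loc_mor_eq/ceq_sym/fmap1.
Qed.

Definition lift_functor : functor (localization S) (localization S') :=
  @Functor (localization S) (localization S') F lift_hom lift_hom_eq
    (fun X => loc_mor_eq S' (fmap1 F X)) (fun X Y Z g f => ceq_refl _).

End Lift.

(** Induction on formal composites: at an inverse, the square of [s] is conjugated by the images of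
    [s] and [loc_inv Ss]. The components [t] are required at every object because a composite may
    pass through any of them. *)
Lemma natural_on_localization (E : category)
    (P Q : functor (localization S) E) (t : forall X : C, P X ~> Q X) :
  (forall X Y (f : X ~> Y),
     t Y \c fmap P (loc_mor S f) ==~ fmap Q (loc_mor S f) \c t X) ->
  forall X Y (phi : loc_hom S X Y), t Y \c fmap P phi ==~ fmap Q phi \c t X.
Proof.
move=> nat_mor X Y; elim=> {X Y} [X Y f|X Y s Ss|X Y Z g IHg f IHf].
- exact: nat_mor.
- have eQ : fmap Q (loc_inv Ss) \c fmap Q (loc_mor S s) ==~ cid (Q X).
    by rewrite -(fmapM Q) -(fmap1 Q); apply/fmap_eq/loc_invl.
  have eP : fmap P (loc_mor S s) \c fmap P (loc_inv Ss) ==~ cid (P Y).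
    by rewrite -(fmapM P) -(fmap1 P); apply/fmap_eq/loc_invr.
  rewrite -[t X]ccomp1l -eQ -[_ \c _ \c t X]ccompA -nat_mor -!ccompA eP ccomp1r.
  reflexivity.
- have eP := fmapM P (g : @chom (localization S) Y Z)
                     (f : @chom (localization S) X Y).
  have eQ := fmapM Q (g : @chom (localization S) Y Z)
                     (f : @chom (localization S) X Y).
  apply: (ceq_trans (ccomp_eq (ceq_refl _) eP)).
  apply: ceq_sym; apply: (ceq_trans (ccomp_eq eQ (ceq_refl _))).
  by rewrite -ccompA -IHf ccompA -IHg ccompA.
Qed.

(** The inverse of [r \c t] is the inverse of [t] after that of [r], and the square rewrites [b] as
    the inverse of [r] after [c \c s]; then [s] cancels. *)
Lemma fraction_calculus_comp_left X Y V Z W U (a : X ~> Z) (s : Y ~> Z)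
    (Ss : S s) (b : Y ~> W) (t : V ~> W) (St : S t)
    (c : Z ~> U) (r : W ~> U) (Srt : S (r \c t)) :
  S r -> r \c b ==~ c \c s ->
  loc_eq (loc_comp (left_fraction St b) (left_fraction Ss a))
         (left_fraction Srt (c \c a)).
Proof.
move=> Sr e; rewrite /left_fraction.
have -> : loc_eq (loc_inv Srt) (loc_comp (loc_inv St) (loc_inv Sr)).
  rewrite -[loc_comp _ (loc_inv Sr)]loc_1r -(loc_invr Srt) loc_mor_comp.
  rewrite !loc_A -[loc_comp (loc_comp _ (loc_inv Sr)) _]loc_A loc_invl loc_1r.
  by rewrite loc_invl loc_1l.
have -> : loc_eq (loc_mor S b)
            (loc_comp (loc_inv Sr) (loc_comp (loc_mor S c) (loc_mor S s))).
  by rewrite -loc_mor_comp -(loc_mor_eq S e) loc_mor_comp loc_A loc_invl loc_1l.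
rewrite loc_mor_comp !loc_A.
by rewrite -[loc_comp (loc_comp _ (loc_mor S s)) _]loc_A loc_invr loc_1r.
Qed.

Lemma fraction_calculus_comp_right X Y V Z W U (a : Z ~> Y) (s : Z ~> X)
    (Ss : S s) (b : W ~> V) (t : W ~> Y) (St : S t)
    (c : U ~> W) (r : U ~> Z) (Ssr : S (s \c r)) :
  S r -> a \c r ==~ t \c c ->
  loc_eq (loc_comp (right_fraction b St) (right_fraction a Ss))
         (right_fraction (b \c c) Ssr).
Proof.
move=> Sr e; rewrite /right_fraction.
have -> : loc_eq (loc_inv Ssr) (loc_comp (loc_inv Sr) (loc_inv Ss)).
  rewrite -[loc_comp _ (loc_inv Ss)]loc_1r -(loc_invr Ssr) loc_mor_comp.
  rewrite !loc_A -[loc_comp (loc_comp _ (loc_inv Ss)) _]loc_A loc_invl loc_1r.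
  by rewrite loc_invl loc_1l.
have -> : loc_eq (loc_mor S a)
            (loc_comp (loc_comp (loc_mor S t) (loc_mor S c)) (loc_inv Sr)).
  by rewrite -loc_mor_comp -(loc_mor_eq S e) loc_mor_comp -loc_A loc_invr loc_1r.
rewrite loc_mor_comp !loc_A.
by rewrite -[loc_comp (loc_comp _ (loc_inv St)) _]loc_A loc_invl loc_1r.
Qed.

Hypothesis mS : multiplicative_system S.

(** In a composite, the Ore condition moves the denominator of the first fraction past the numerator
    of the second. *)
Lemma left_fraction_repr X Y (phi : loc_hom S X Y) :
  exists Z (a : X ~> Z) (s : Y ~> Z) (Ss : S s), loc_eq phi (left_fraction Ss a).
Proof.
elim: phi => {X Y} [X Y f|X Y s Ss|X Y V g [W [b [t [St eg]]]] f [Z [a [s [Ss ef]]]]].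
- exists Y, f, (cid Y), (ms_id mS Y).
  rewrite /left_fraction -[loc_inv _]loc_1r loc_invl.
  by rewrite loc_1l.
- by exists Y, (cid Y), s, Ss; rewrite /left_fraction loc_1r.
- have [U [c [r [Sr e]]]] := ms_ore_left mS b Ss.
  exists U, (c \c a), (r \c t), (ms_comp mS Sr St).
  by rewrite eg ef; apply: fraction_calculus_comp_left.
Qed.

Lemma right_fraction_repr X Y (phi : loc_hom S X Y) :
  exists Z (a : Z ~> Y) (s : Z ~> X) (Ss : S s), loc_eq phi (right_fraction a Ss).
Proof.
elim: phi => {X Y} [X Y f|X Y s Ss|X Y V g [W [b [t [St eg]]]] f [Z [a [s [Ss ef]]]]].
- exists X, f, (cid X), (ms_id mS X).
  rewrite /right_fraction -[loc_inv _]loc_1r loc_invl.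
  by rewrite loc_1r.
- by exists X, (cid X), s, Ss; rewrite /right_fraction loc_1l.
- have [U [c [r [Sr e]]]] := ms_ore_right mS a St.
  exists U, (b \c c), (s \c r), (ms_comp mS Ss Sr).
  by rewrite eg ef; apply: fraction_calculus_comp_right.
Qed.

(** The inverse of [u \c s], precomposed with [u], is a left inverse of the invertible [s], hence
    its inverse. Membership in [S] is asked of [u \c s] only, as in the criterion for equality of
    fractions. *)
Lemma left_fraction_expand X Y Z W (a : X ~> Z) (s : Y ~> Z) (Ss : S s)
    (u : Z ~> W) (Sus : S (u \c s)) :
  loc_eq (left_fraction Ss a) (left_fraction Sus (u \c a)).
Proof.
rewrite /left_fraction; set i := loc_inv Sus.
have e : loc_eq (loc_comp i (loc_mor S u)) (loc_inv Ss).
  rewrite -[loc_comp i _]loc_1r -(loc_invr Ss) loc_A -[loc_comp (loc_comp i _) _]loc_A.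
  by rewrite -loc_mor_comp loc_invl loc_1l.
by rewrite loc_mor_comp loc_A e.
Qed.

Lemma right_fraction_expand X Y Z W (a : Z ~> Y) (s : Z ~> X) (Ss : S s)
    (u : W ~> Z) (Ssu : S (s \c u)) :
  loc_eq (right_fraction a Ss) (right_fraction (a \c u) Ssu).
Proof.
rewrite /right_fraction; set i := loc_inv Ssu.
have e : loc_eq (loc_comp (loc_mor S u) i) (loc_inv Ss).
  rewrite -[loc_comp _ i]loc_1l -(loc_invl Ss) -loc_A [loc_comp _ (loc_comp _ i)]loc_A.
  by rewrite -loc_mor_comp loc_invr loc_1r.
by rewrite loc_mor_comp -loc_A e.
Qed.

(** A formal inverse carries a proof of membership; uniqueness of inverses makes it independent of
    that proof and of the representative. *)
Lemma loc_inv_eq X Y (s t : X ~> Y) (Ss : S s) (St : S t) :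
  s ==~ t -> loc_eq (loc_inv Ss) (loc_inv St).
Proof.
move=> est; rewrite -[loc_inv Ss]loc_1r -(loc_invr St) loc_A.
by rewrite -(loc_mor_eq S est) loc_invl loc_1l.
Qed.

Lemma left_fraction_eq X Y Z (a b : X ~> Z) (s t : Y ~> Z) (Ss : S s) (St : S t) :
  a ==~ b -> s ==~ t -> loc_eq (left_fraction Ss a) (left_fraction St b).
Proof.
move=> eab est; apply: loc_comp_eq (loc_mor_eq S eab).
exact: loc_inv_eq.
Qed.

Lemma right_fraction_eq X Y Z (a b : Z ~> Y) (s t : Z ~> X) (Ss : S s) (St : S t) :
  a ==~ b -> s ==~ t -> loc_eq (right_fraction a Ss) (right_fraction b St).
Proof.
move=> eab est; apply: loc_comp_eq (loc_mor_eq S eab) _.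
exact: loc_inv_eq.
Qed.

End LocalizationFunctors.

(** * Matrix calculus and kernels *)

Section Matrices.
Context (A : additive_category).

Lemma apr1_col (X Y Z : A) (a : Z ⟶ X) (b : Z ⟶ Y) : apr1 ∘ col_mor a b = a.
Proof.
by rewrite /col_mor acompDr !acompA apr1_in1 apr1_in2 acomp1l acomp0l addr0.
Qed.

Lemma apr2_col (X Y Z : A) (a : Z ⟶ X) (b : Z ⟶ Y) : apr2 ∘ col_mor a b = b.
Proof.
by rewrite /col_mor acompDr !acompA apr2_in1 apr2_in2 acomp1l acomp0l add0r.
Qed.

Lemma col_eta (X Y Z : A) (c : Z ⟶ X ⊕ Y) : c = col_mor (apr1 ∘ c) (apr2 ∘ c).
Proof. by rewrite /col_mor !acompA -acompDl abipP acomp1l. Qed.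

Lemma col_mor_inj (X Y Z : A) (a a' : Z ⟶ X) (b b' : Z ⟶ Y) :
  col_mor a b = col_mor a' b' -> a = a' /\ b = b'.
Proof.
by move=> e; rewrite -[a](apr1_col a b) -[b in _ /\ b = _](apr2_col a b) e
  apr1_col apr2_col.
Qed.

Lemma col_mor0 (X Y Z : A) : col_mor (0 : Z ⟶ X) (0 : Z ⟶ Y) = 0.
Proof. by rewrite /col_mor !acomp0r addr0. Qed.

Lemma col_morN (X Y Z : A) (a : Z ⟶ X) (b : Z ⟶ Y) :
  - col_mor a b = col_mor (- a) (- b).
Proof. by rewrite /col_mor !acompNr opprD. Qed.

Lemma col_morD (X Y Z : A) (a a' : Z ⟶ X) (b b' : Z ⟶ Y) :
  col_mor a b + col_mor a' b' = col_mor (a + a') (b + b').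
Proof. by rewrite /col_mor !acompDr addrACA. Qed.

Lemma zero_to (X Y : A) : aid Y = 0 -> forall f : X ⟶ Y, f = 0.
Proof. by move=> Y0 f; rewrite -[f]acomp1l Y0 acomp0l. Qed.

Lemma zero_from (X Y : A) : aid X = 0 -> forall f : X ⟶ Y, f = 0.
Proof. by move=> X0 f; rewrite -[f]acomp1r X0 acomp0r. Qed.

Lemma is_iso_id (X : A) : is_iso (aid X).
Proof. by exists (aid X); rewrite acomp1l. Qed.

Lemma is_kernel_mono (K X Y : A) (k : K ⟶ X) (f : X ⟶ Y) : is_kernel k f ->
  forall T (u v : T ⟶ K), k ∘ u = k ∘ v -> u = v.
Proof.
move=> [fk kU] T u v e.
have [|w [_ wU]] := kU T (k ∘ u); first by rewrite acompA fk acomp0l.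
by rewrite -(wU u) // -(wU v).
Qed.

(** The lift is extracted as data by indefinite description, since differentials and cochain maps
    are later built from such lifts. *)
Lemma is_kernel_lift (K X Y : A) (k : K ⟶ X) (f : X ⟶ Y) : is_kernel k f ->
  forall T (t : T ⟶ X), f ∘ t = 0 -> {u : T ⟶ K | k ∘ u = t}.
Proof.
move=> kf T t ft; apply: constructive_indefinite_description.
by have [u [ku _]] := kf.2 T t ft; exists u.
Qed.

Lemma is_kernelI (K X Y : A) (k : K ⟶ X) (f : X ⟶ Y) : f ∘ k = 0 ->
  (forall T (u v : T ⟶ K), k ∘ u = k ∘ v -> u = v) ->
  (forall T (t : T ⟶ X), f ∘ t = 0 -> exists u : T ⟶ K, k ∘ u = t) ->
  is_kernel k f.
Proof.
move=> fk kI kL; split=> // T t /kL[u ku]; exists u; split=> // v kv.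
by apply: kI; rewrite ku.
Qed.

Lemma is_kernel_uniq (K K' X Y : A) (k : K ⟶ X) (k' : K' ⟶ X) (f : X ⟶ Y) :
  is_kernel k f -> is_kernel k' f -> exists a : K ⟶ K', is_iso a /\ k' ∘ a = k.
Proof.
move=> kf kf'; have [a ka] := is_kernel_lift kf' kf.1.
have [b kb] := is_kernel_lift kf kf'.1.
exists a; split=> //; exists b.
by split; [apply: (is_kernel_mono kf)|apply: (is_kernel_mono kf')];
  rewrite acompA ?kb ?ka ?kb acomp1r.
Qed.

End Matrices.

(** * The topology of deflations *)

Section DeflationTopology.
Context (A : additive_category) (CC : pair_class A).
Hypothesis hCC : strongly_deflation_exact CC.
Hypothesis hker : has_kernels A.

Notation cover := (@deflation A CC _ _).

Lemma confl_cover X Y Z (k : X ⟶ Y) (p : Y ⟶ Z) : CC k p -> cover p.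
Proof. by move=> kp; exists X, k. Qed.

(** Kernels are unique up to isomorphism and conflations are closed under isomorphism. *)
Lemma confl_of_kernel X Y Z (k : X ⟶ Y) (p : Y ⟶ Z) :
  is_kernel k p -> cover p -> CC k p.
Proof.
move=> kp [K [k' k'p]]; have hC := sde_conflation hCC.
have [a [isoa ka]] := is_kernel_uniq (confl_ker hC k'p) kp.
apply: (confl_iso hC isoa (is_iso_id _) (is_iso_id _) _ _ k'p).
  by rewrite ka acomp1l.
by rewrite acomp1l acomp1r.
Qed.

(** This form of (R3) is the source of new deflations: a local lift of the generic element [aid]
    along [p] shows that [p] is a cover. *)
Lemma cover_of_section X Y Z (p : Y ⟶ Z) (s : X ⟶ Y) : cover (p ∘ s) -> cover p.
Proof. by apply: (sde_R3 hCC); apply: hker. Qed.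

Lemma cover_id X : cover (aid X).
Proof.
(* Pulling back the deflation from [azero] to itself yields some cover [p'] of [X], and [p'] factors
   through the identity. *)
have [P [f' [p' [_ cp]]]] := sde_R2 hCC (0 : X ⟶ azero) (sde_R0 hCC azero).
by apply: (cover_of_section (s := p')); rewrite acomp1l.
Qed.

Lemma cover_comp X Y Z (q : Y ⟶ Z) (p : X ⟶ Y) :
  cover q -> cover p -> cover (q ∘ p).
Proof. exact: (sde_R1 hCC). Qed.

Lemma cover_pull Y W Z (p : Y ⟶ Z) (f : W ⟶ Z) : cover p ->
  exists P (f' : P ⟶ Y) (p' : P ⟶ W), cover p' /\ p ∘ f' = f ∘ p'.
Proof.
move=> cp; have [P [f' [p' [[e _] cp']]]] := sde_R2 hCC f cp.
by exists P, f', p'.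
Qed.

Section Congruence.
Context (X : hmor_ob A).

(* The relation [cong x y] says that x and y define the same section of the
   sheaf cokernel of [hf X] for the topology of deflations. *)
Definition cong T (x y : T ⟶ hX X) : Prop :=
  exists T' (q : T' ⟶ T) (x' : T' ⟶ hX' X), cover q /\ (x - y) ∘ q = hf X ∘ x'.

Lemma cong_im T (x y : T ⟶ hX X) x' : x - y = hf X ∘ x' -> cong x y.
Proof. by exists T, (aid T), x'; rewrite acomp1r; split=> //; apply: cover_id. Qed.

Lemma cong_refl T (x : T ⟶ hX X) : cong x x.
Proof. by apply: (cong_im (x' := 0)); rewrite subrr acomp0r. Qed.

Lemma cong_sym T (x y : T ⟶ hX X) : cong x y -> cong y x.
Proof.
move=> [T' [q [x' [cq e]]]]; exists T', q, (- x'); split=> //.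
by rewrite acompNr -e -acompNl opprB.
Qed.

Lemma cong_pre T T' (x y : T ⟶ hX X) (e : T' ⟶ T) :
  cong x y -> cong (x ∘ e) (y ∘ e).
Proof.
move=> [U [q [x' [cq eq]]]]; have [P [f [p [cp ep]]]] := cover_pull e cq.
exists P, p, (x' ∘ f); split=> //.
by rewrite -acompBl -acompA -ep !acompA eq.
Qed.

Lemma cong_local T T' (x y : T ⟶ hX X) (q : T' ⟶ T) :
  cover q -> cong (x ∘ q) (y ∘ q) -> cong x y.
Proof.
move=> cq [U [r [x' [cr e]]]]; exists U, (q ∘ r), x'.
by split; [apply: cover_comp|rewrite acompA acompBl].
Qed.

Lemma congD T (x y x' y' : T ⟶ hX X) :
  cong x y -> cong x' y' -> cong (x + x') (y + y').
Proof.
move=> [U [q [z [cq e]]]] /(cong_pre q)[V [r [z' [cr e']]]].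
exists V, (q ∘ r), (z ∘ r + z'); split; first exact: cover_comp.
by rewrite opprD addrACA acompDl acompDr !acompA e -e' -acompBl.
Qed.

Lemma congN T (x y : T ⟶ hX X) : cong x y -> cong (- x) (- y).
Proof.
move=> [U [q [z [cq e]]]]; exists U, q, (- z); split=> //.
by rewrite -opprD acompNl e acompNr.
Qed.

Lemma cong_trans T (x y z : T ⟶ hX X) : cong x y -> cong y z -> cong x z.
Proof.
(* Adding both congruences and subtracting [y] reuses the common refinement of covers made in
   [congD]. *)
move=> exy eyz; have := congD (congD exy eyz) (congN (cong_refl y)).
by rewrite [x + y]addrC [y + z]addrC !addrK addrAC subrr add0r.
Qed.

End Congruence.

(** * Morphisms inducing isomorphisms of cokernel sheaves *)

Lemma hmor_of_mor (X Y : A) (f : X ⟶ Y) :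
  {K : A & {k : K ⟶ X | is_kernel k f}}.
Proof.
have [K Kk] := constructive_indefinite_description _ (hker f).
by exists K; apply: constructive_indefinite_description.
Qed.

Definition hmor_of (X Y : A) (f : X ⟶ Y) : hmor_ob A :=
  HMorOb (svalP (projT2 (hmor_of_mor f))).

(** The component between the kernels is forced by the commuting square. *)
Lemma hmor_lift (X Y : hmor_ob A) (a' : hX' X ⟶ hX' Y) (a : hX X ⟶ hX Y) :
  hf Y ∘ a' = a ∘ hf X -> {b : hmor_mor X Y | ha' b = a' /\ ha b = a}.
Proof.
move=> e; have [|a'' ea] := is_kernel_lift (hkP Y) (t := a' ∘ hk X).
  by rewrite acompA e -acompA (hkP X).1 acomp0r.
by exists (HMorMor ea e).
Qed.

(** Injectivity is tested at zero only, by additivity. A witness [y'] existing only on a cover would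
    do as well, after refining [q]. *)
Definition locally_injective (X Y : hmor_ob A) (a : hmor_mor X Y) : Prop :=
  forall T (x : T ⟶ hX X) (y' : T ⟶ hX' Y), ha a ∘ x = hf Y ∘ y' ->
    exists T' (q : T' ⟶ T) (x' : T' ⟶ hX' X), cover q /\ x ∘ q = hf X ∘ x'.

Definition locally_surjective (X Y : hmor_ob A) (a : hmor_mor X Y) : Prop :=
  forall T (y : T ⟶ hX Y), exists T' (q : T' ⟶ T) (x : T' ⟶ hX X)
    (y' : T' ⟶ hX' Y), cover q /\ y ∘ q = ha a ∘ x + hf Y ∘ y'.

(* Members of S_confl are the morphisms inducing isomorphisms between the
   cokernel sheaves for the topology of deflations. *)
Lemma S_conflP (X Y : hmor_ob A) (a : hmor_mor X Y) :
  S_confl CC a <-> locally_injective a /\ locally_surjective a.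
Proof.
split=> [[K [k [r [kP kr c1 c2]]]]|[inj surj]].
- split=> [T x y' e|T y].
    (* The pair [(x, -y')] lies in the kernel of the row, and the deflation [r] lifts it locally;
       the sign in the matrix entry [- hf X] makes [x'] the negated first component. *)
    have [|u ku] := is_kernel_lift kP (t := col_mor x (- y')).
      by rewrite row_col acompNr e subrr.
    have [T' [v [q [cq e']]]] := cover_pull u (confl_cover c1).
    exists T', q, (- (apr1 ∘ v)); split=> //.
    have := congr1 (acomp k) e'; rewrite !acompA kr ku {1}[v]col_eta.
    rewrite /block_mor !col_morM row_col => /col_mor_inj[<- _].
    by rewrite acompNl acomp0l addr0 acompNr.
  have [T' [v [q [cq e']]]] := cover_pull y (confl_cover c2).
  exists T', q, (apr1 ∘ v), (apr2 ∘ v).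
  by split=> //; rewrite -row_col -col_eta.
have [K [k kP]] := hker (row_mor (ha a) (hf Y)).
have [|r kr] := is_kernel_lift kP
  (t := block_mor (- hf X) 0 (ha' a) (hk Y)).
  rewrite /block_mor row_col !row_morM row_morD (hkP Y).1 !acomp0r addr0.
  by rewrite acompNr ha_f addNr /row_mor !acomp0l addr0.
exists K, k, r; split=> //; last first.
  apply: confl_of_kernel => //.
  (* Surjectivity at the generic element provides a local section of the row. *)
  have [T' [q [x [y' [cq e]]]]] := surj _ (aid (hX Y)).
  apply: (cover_of_section (s := col_mor x y')).
  by rewrite row_col -e acomp1l.
apply: confl_of_kernel => //.
  apply: is_kernelI.
  - apply: (is_kernel_mono kP); rewrite acompA kr acomp0r /block_mor col_morM.
    rewrite !row_col ha_k acomp0l addr0 acompNl acompNr opprK (hkP X).1.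
    by rewrite acompNr addNr col_mor0.
  - move=> T u v; rewrite !col_morM => /col_mor_inj[e _].
    by apply: (is_kernel_mono (hkP X)); apply: oppr_inj; rewrite -!acompNl.
  - move=> T t rt; have := congr1 (acomp k) rt; rewrite acompA kr acomp0r.
    rewrite {1}[t]col_eta /block_mor col_morM !row_col -col_mor0.
    move=> /col_mor_inj[e1 e2].
    have [|u ku] := is_kernel_lift (hkP X) (t := apr1 ∘ t).
      by apply: oppr_inj; rewrite oppr0 -acompNl -e1 acomp0l addr0.
    exists (- u); rewrite [RHS]col_eta col_morM acompNr acompNl opprK ku.
    congr col_mor; apply: (is_kernel_mono (hkP Y)); rewrite acompNr acompNr.
    rewrite acompA ha_k -acompA ku; apply/eqP; rewrite eq_sym -addr_eq0 addrC.
    exact/eqP.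
(* Injectivity is applied to the generic kernel element [k]. It makes [apr1 ∘ k] locally a boundary
   of some [x']; the defect in the second component is killed by [hf Y] and gives [y'']. Together
   they form a local section of [r]. *)
have e : ha a ∘ (apr1 ∘ k) = hf Y ∘ (- (apr2 ∘ k)).
  apply/eqP; rewrite acompNr -addr_eq0 -row_col -col_eta.
  by apply/eqP; exact: kP.1.
have [T' [q [x' [cq ex]]]] := inj _ _ _ e.
have [|y'' ey] := is_kernel_lift (hkP Y) (t := apr2 ∘ k ∘ q + ha' a ∘ x').
  rewrite acompDr !acompA ha_f -[_ ∘ hf X ∘ x']acompA -ex !acompA.
  rewrite -[ha a ∘ _ ∘ k]acompA e.
  by rewrite acompNr acompNl !acompA addrN.
apply: (cover_of_section (s := col_mor (- x') y'')).
suff -> : r ∘ col_mor (- x') y'' = q by [].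
apply: (is_kernel_mono kP); rewrite acompA kr /block_mor col_morM !row_col ey.
rewrite acompNl !acompNr opprK acomp0l addr0 -ex addrC addrK.
by rewrite [RHS]col_eta !acompA.
Qed.

(** A homotopy [rho] moves the image of [x] by the boundary of [rho ∘ x], which is absorbed in
    [y']. *)
Lemma S_confl_respects (X Y : hmor_ob A) (a b : hmor_mor X Y) :
  hmor_eq a b -> S_confl CC a -> S_confl CC b.
Proof.
move=> [rho e] /S_conflP[inj surj]; apply/S_conflP; split.
- move=> T x y' eb; apply: (inj _ _ (y' + rho ∘ x)).
  by rewrite acompDr -eb acompA -e acompBl [RHS]addrC subrK.
- move=> T y; have [T' [q [x [y' [cq ey]]]]] := surj T y.
  exists T', q, x, (y' + rho ∘ x); split=> //.
  rewrite acompDr acompA -e acompBl addrCA [ha b ∘ x + _]addrC subrK.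
  by rewrite ey addrC.
Qed.

Lemma S_confl_id (X : hmor_ob A) : S_confl CC (hmor_id X).
Proof.
apply/S_conflP; split=> [T x y' /=|T y].
  rewrite acomp1l => ->; exists T, (aid T), y'.
  by rewrite acomp1r; split=> //; apply: cover_id.
exists T, (aid T), y, 0; rewrite /= acomp0r addr0 acomp1r acomp1l.
by split=> //; apply: cover_id.
Qed.

Lemma locally_injective_comp (X Y Z : hmor_ob A) (b : hmor_mor Y Z)
    (a : hmor_mor X Y) :
  locally_injective b -> locally_injective a ->
  locally_injective (hmor_comp b a).
Proof.
move=> injb inja T x z' /=; rewrite -acompA => /injb[T' [q [y' [cq]]]].
rewrite -acompA => /inja[U [r [x' [cr e]]]].
exists U, (q ∘ r), x'; split; first exact: cover_comp.
by rewrite acompA.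
Qed.

Lemma locally_surjective_comp (X Y Z : hmor_ob A) (b : hmor_mor Y Z)
    (a : hmor_mor X Y) :
  locally_surjective b -> locally_surjective a ->
  locally_surjective (hmor_comp b a).
Proof.
move=> surjb surja T z; have [T' [q [y [z' [cq ez]]]]] := surjb T z.
have [U [r [x [y' [cr ey]]]]] := surja T' y.
exists U, (q ∘ r), x, (ha' b ∘ y' + z' ∘ r); split; first exact: cover_comp.
rewrite acompA ez acompDl -!acompA ey /= !acompDr !acompA ha_f.
by rewrite addrA.
Qed.

Lemma locally_injective_cancel (X Y Z : hmor_ob A) (b : hmor_mor Y Z)
    (a : hmor_mor X Y) :
  locally_injective (hmor_comp b a) -> locally_injective a.
Proof.
move=> inj T x y' e; apply: (inj T x (ha' b ∘ y')) => /=.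
by rewrite -acompA e !acompA ha_f.
Qed.

Lemma locally_surjective_cancel (X Y Z : hmor_ob A) (b : hmor_mor Y Z)
    (a : hmor_mor X Y) :
  locally_surjective (hmor_comp b a) -> locally_surjective b.
Proof.
move=> surj T z; have [T' [q [x [z' [cq ez]]]]] := surj T z.
by exists T', q, (ha a ∘ x), z'; rewrite acompA.
Qed.

(** * Saturation, Ore and cancellation conditions *)

Lemma S_confl_saturated : saturated (S_confl CC).
Proof.
move=> X Y Z W f g h /S_conflP[inj _] /S_conflP[_ surj]; apply/S_conflP.
by split; [apply: locally_injective_cancel inj|
           apply: locally_surjective_cancel surj].
Qed.

(** [P] is a homotopy pushout: its cokernel sheaf is the sum of those of [X'] and [Y], with the
    images of [hX X] under [s] and [a] identified. *)
Lemma ore_left (X X' Y : hmor_ob A) (a : hmor_mor X Y) (s : hmor_mor X X') :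
  S_confl CC s -> exists Y' (a' : hmor_mor X' Y') (s' : hmor_mor Y Y'),
    S_confl CC s' /\ hmor_eq (hmor_comp s' a) (hmor_comp a' s).
Proof.
move=> /S_conflP[inj surj].
pose P := hmor_of (col_mor
  (hf X' ∘ apr1 ∘ apr1 + ha s ∘ apr2 : (hX' X' ⊕ hX' Y) ⊕ hX X ⟶ hX X')
  (hf Y ∘ apr2 ∘ apr1 - ha a ∘ apr2)).
have fP T (w : T ⟶ hX' X') (y : T ⟶ hX' Y) (x : T ⟶ hX X) :
    hf P ∘ col_mor (col_mor w y) x
    = col_mor (hf X' ∘ w + ha s ∘ x) (hf Y ∘ y - ha a ∘ x).
  by rewrite col_morM acompBl !acompDl -!acompA !apr1_col !apr2_col.
have [|s' [es1 es0]] := @hmor_lift Y P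
    (col_mor (col_mor 0 (aid _)) 0) (col_mor 0 (aid _)).
  by rewrite fP col_morM !acomp0l !acomp0r addr0 subr0 acomp1l acomp1r.
have [|a' [ea1 ea0]] := @hmor_lift X' P
    (col_mor (col_mor (aid _) 0) 0) (col_mor (aid _) 0).
  by rewrite fP col_morM !acomp0l !acomp0r addr0 subr0 acomp1l acomp1r.
exists P, a', s'; split; last first.
  (* The added summand [hX X] is itself the homotopy. *)
  exists (col_mor (col_mor 0 0) (- aid _)).
  rewrite /= es0 ea0 fP !col_morM col_morN col_morD !acomp0l !acomp0r !acompNr.
  by rewrite !acomp1l !acomp1r !add0r subr0 opprK.
apply/S_conflP; split=> [T y p|T p].
  have [w1 [y1 [x0 ->]]] : exists w1 y1 x0, p = col_mor (col_mor w1 y1) x0.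
    by do 3!eexists; rewrite [LHS]col_eta; congr col_mor; apply: col_eta.
  rewrite es0 fP col_morM acomp0l acomp1l => /col_mor_inj[ex ey].
  (* The first component says that [s] maps [x0] to a boundary, so [x0] is locally a boundary and so
     is its image under [a]. *)
  have [|T' [q [x1 [cq e1]]]] := inj _ x0 (- w1).
    by apply/eqP; rewrite acompNr -addr_eq0 ex addrC.
  exists T', q, (y1 ∘ q - ha' a ∘ x1); split=> //.
  by rewrite ey acompBl acompBr -[ha a ∘ _ ∘ q]acompA e1 !acompA ha_f.
have [T' [q [x [w' [cq e]]]]] := surj _ (apr1 ∘ p).
exists T', q, (apr2 ∘ p ∘ q + ha a ∘ x), (col_mor (col_mor w' 0) x); split=> //.
rewrite fP es0 col_morM acomp0l acomp0r sub0r acomp1l col_morD add0r addrK.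
by rewrite [hf X' ∘ _ + _]addrC -e -col_morM -col_eta.
Qed.

(** Homotopy pullback: [K] consists of triples [(x, w, y)] in which [y] witnesses that the images of
    [x] and [w] are congruent. They are taken modulo the boundaries of [x] and [w] and the ambiguity
    [hK Y] of [y]; the projection to [y] is the homotopy. *)
Lemma ore_right (X Y Y' : hmor_ob A) (a : hmor_mor X Y) (s : hmor_mor Y' Y) :
  S_confl CC s -> exists X' (a' : hmor_mor X' Y') (s' : hmor_mor X' X),
    S_confl CC s' /\ hmor_eq (hmor_comp a s') (hmor_comp s a').
Proof.
move=> /S_conflP[inj surj].
pose g : (hX X ⊕ hX Y') ⊕ hX' Y ⟶ hX Y :=
  ha a ∘ apr1 ∘ apr1 - ha s ∘ apr2 ∘ apr1 - hf Y ∘ apr2.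
have gE T x w y : g ∘ col_mor (col_mor x w) y
    = ha a ∘ x - ha s ∘ w - hf Y ∘ y :> (T ⟶ _).
  by rewrite /g !acompBl -!acompA !apr1_col !apr2_col.
have [K [k kP]] := hker g.
pose m : (hX' X ⊕ hX' Y') ⊕ hK Y ⟶ (hX X ⊕ hX Y') ⊕ hX' Y :=
  col_mor (col_mor (hf X ∘ apr1 ∘ apr1) (hf Y' ∘ apr2 ∘ apr1))
    (ha' a ∘ apr1 ∘ apr1 - ha' s ∘ apr2 ∘ apr1 + hk Y ∘ apr2).
have mE T x w z : m ∘ col_mor (col_mor x w) z
    = col_mor (col_mor (hf X ∘ x) (hf Y' ∘ w))
        (ha' a ∘ x - ha' s ∘ w + hk Y ∘ z) :> (T ⟶ _).
  by rewrite /m !col_morM acompDl acompBl -!acompA !apr1_col !apr2_col.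
have [|f kf] := is_kernel_lift kP (t := m).
  rewrite /m gE acompDr acompBr !acompA !ha_f (hkP Y).1 acomp0l addr0.
  by rewrite subrr.
pose P := hmor_of f.
have [|s' [es1 es0]] := @hmor_lift P X (apr1 ∘ apr1) (apr1 ∘ apr1 ∘ k).
  by rewrite -[RHS]acompA kf -acompA !apr1_col acompA.
have [|a' [ea1 ea0]] := @hmor_lift P Y' (apr2 ∘ apr1) (apr2 ∘ apr1 ∘ k).
  by rewrite -[RHS]acompA kf -acompA apr1_col apr2_col acompA.
exists P, a', s'; split; last first.
  exists (apr2 ∘ k); rewrite /= es0 ea0; apply/eqP; rewrite -subr_eq0.
  by rewrite !acompA -2!acompBl kP.1.
apply/S_conflP; split=> [T v x1|T x].
  rewrite es0 -!acompA => ex.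
  have := congr1 (fun t => t ∘ v) kP.1; rewrite acomp0l -acompA.
  set kv := k ∘ v in ex *; rewrite [kv]col_eta [apr1 ∘ kv]col_eta gE ex.
  move=> /eqP; rewrite subr_eq0 => /eqP ey.
  (* As the first component is the boundary of [x1], the image of the second under [s] is a
     boundary, hence the second is locally one. What is left of the third component lies in
     [hK Y]. *)
  have [|T' [q [w1 [cq ew]]]] := inj _ (apr2 ∘ (apr1 ∘ kv))
      (ha' a ∘ x1 - apr2 ∘ kv).
    rewrite acompBr -ey [hf Y ∘ _]acompA ha_f -[ha a ∘ _ ∘ x1]acompA.
    by rewrite opprB addrC subrK.
  have [|z kz] := is_kernel_lift (hkP Y)
      (t := apr2 ∘ kv ∘ q - (ha' a ∘ (x1 ∘ q) - ha' s ∘ w1)).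
    rewrite !acompBr [hf Y ∘ (_ ∘ q)]acompA -ey [hf Y ∘ (ha' a ∘ _)]acompA.
    rewrite [hf Y ∘ (ha' s ∘ _)]acompA !ha_f -[ha s ∘ _ ∘ w1]acompA -ew acompBl.
    by rewrite !acompA subrr.
  exists T', q, (col_mor (col_mor (x1 ∘ q) w1) z); split=> //.
  apply: (is_kernel_mono kP); rewrite !acompA -/kv kf mE kz addrC subrK.
  by rewrite -ew [hf X ∘ _]acompA -ex -2!col_morM -2!col_eta.
have [T' [q [w [y' [cq e]]]]] := surj _ (ha a ∘ x).
have [|u ku] := is_kernel_lift kP (t := col_mor (col_mor (x ∘ q) w) y').
  by rewrite gE acompA e addrAC addrK subrr.
exists T', q, u, 0; split=> //.
by rewrite es0 -[_ ∘ k ∘ u]acompA ku -[apr1 ∘ _ ∘ _]acompA !apr1_col acomp0r addr0.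
Qed.

(** Adjoining the difference of [f] and [g] to the boundaries of [Y] makes them homotopic. That
    difference was locally a boundary already, so the cokernel sheaf does not change. *)
Lemma equalize_left (X Y : hMor_ker A) (f g : X ~> Y) :
  cong (ha f) (ha g) -> exists Y' (t : Y ~> Y'),
    S_confl CC t /\ t \c f ==~ t \c g.
Proof.
move=> [T0 [q0 [x0 [cq0 e0]]]].
pose P := hmor_of (row_mor (hf Y) (ha f - ha g)).
have [|t [et1 et0]] := @hmor_lift Y P (col_mor (aid _) 0) (aid _).
  by rewrite row_col acomp0r addr0 acomp1l acomp1r.
exists P, t; split; last first.
  exists (col_mor 0 (aid _)).
  by rewrite /= et0 row_col !acomp1l acomp1r acomp0r add0r.
apply/S_conflP; split=> [T y p|T y].
  rewrite et0 acomp1l [p]col_eta row_col => ->.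
  have [T' [v [q [cq e]]]] := cover_pull (apr2 ∘ p) cq0.
  exists T', q, (apr1 ∘ p ∘ q + x0 ∘ v); split=> //.
  rewrite acompDr acompDl [hf Y ∘ (x0 ∘ v)]acompA -e0 -[_ ∘ q0 ∘ v]acompA e.
  by rewrite !acompA.
exists T, (aid T), y, 0; rewrite et0 acomp0r addr0 acomp1r acomp1l.
by split=> //; apply: cover_id.
Qed.

(** Dually, [K] consists of elements [x] with a chosen witness that [f] and [g] agree on them. The
    witness is the homotopy; it exists locally and is unique up to [hK Y]. *)
Lemma equalize_right (X Y : hMor_ker A) (f g : X ~> Y) :
  cong (ha f) (ha g) -> exists X' (s : X' ~> X),
    S_confl CC s /\ f \c s ==~ g \c s.
Proof.
move=> [T0 [q0 [x0 [cq0 e0]]]].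
pose h := ha f - ha g; pose h' := ha' f - ha' g.
have hE : hf Y ∘ h' = h ∘ hf X by rewrite acompBr !ha_f acompBl.
have [K [k kP]] := hker (h ∘ apr1 - hf Y ∘ apr2).
have [|r kr] := is_kernel_lift kP
  (t := col_mor (hf X ∘ apr1) (h' ∘ apr1 + hk Y ∘ apr2)).
  rewrite acompBl -!acompA apr1_col apr2_col acompDr !acompA hE (hkP Y).1.
  by rewrite acomp0l addr0 subrr.
pose P := hmor_of r.
have [|s [es1 es0]] := @hmor_lift P X apr1 (apr1 ∘ k).
  by rewrite -[RHS]acompA kr apr1_col.
exists P, s; split; last first.
  exists (apr2 ∘ k); rewrite /= es0; apply/eqP; rewrite -subr_eq0.
  by rewrite -acompBl -/h !acompA -acompBl kP.1.
apply/S_conflP; split=> [T v x1|T x].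
  rewrite es0 -acompA => ex; set kv := k ∘ v in ex.
  have ey : h ∘ (apr1 ∘ kv) = hf Y ∘ (apr2 ∘ kv).
    apply/eqP; rewrite -subr_eq0 /kv; apply/eqP.
    by rewrite ![_ ∘ (_ ∘ (k ∘ v))]acompA -acompBl acompA kP.1 acomp0l.
  have [|z kz] := is_kernel_lift (hkP Y) (t := apr2 ∘ kv - h' ∘ x1).
    by rewrite acompBr -ey ex !acompA hE subrr.
  exists T, (aid T), (col_mor x1 z); split; first exact: cover_id.
  apply: (is_kernel_mono kP); rewrite acomp1r -/kv [RHS]acompA kr col_morM.
  rewrite acompDl -!acompA apr1_col apr2_col kz addrC subrK -ex.
  exact: col_eta.
have [T' [v [q [cq e]]]] := cover_pull x cq0.
have [|u ku] := is_kernel_lift kP (t := col_mor (x ∘ q) (x0 ∘ v)).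
  rewrite acompBl -!acompA apr1_col apr2_col -e.
  by rewrite [X in _ - X]acompA -e0 -acompA subrr.
exists T', q, u, 0; split=> //.
by rewrite es0 -[_ ∘ k ∘ u]acompA ku apr1_col acomp0r addr0.
Qed.

Lemma S_confl_multiplicative : multiplicative_system (S_confl CC).
Proof.
split.
- exact: S_confl_respects.
- exact: S_confl_id.
- move=> X Y Z t s /S_conflP[injt surjt] /S_conflP[injs surjs]; apply/S_conflP.
  by split; [apply: locally_injective_comp|apply: locally_surjective_comp].
- exact: ore_left.
- exact: ore_right.
- move=> X X' Y f g s /S_conflP[_ surj] [rho e]; apply: equalize_left.
  (* Locally the generic element is an image under [s] plus a boundary; [rho] handles the former,
     the primed components the latter. *)
  have [T' [q [x [y' [cq eq]]]]] := surj _ (aid _).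
  exists T', q, (rho ∘ x + (ha' f - ha' g) ∘ y'); split=> //.
  rewrite -[q]acomp1l eq acompDr acompDr !acompA -e acompBr !ha_f.
  by rewrite -!acompBl.
- move=> X Y Y' f g t /S_conflP[inj _] [rho e]; apply: equalize_right.
  have [|T' [q [x' [cq eq]]]] := inj _ (ha f - ha g) rho; last by exists T', q, x'.
  by rewrite acompBr.
Qed.

(** * Equality of fractions *)

Notation S := (S_confl CC).

Lemma cong_map (X Y : hmor_ob A) (a : hmor_mor X Y) T (x y : T ⟶ hX X) :
  cong x y -> cong (ha a ∘ x) (ha a ∘ y).
Proof.
move=> [T' [q [x' [cq e]]]]; exists T', q, (ha' a ∘ x'); split=> //.
by rewrite -acompBr -acompA e !acompA ha_f.
Qed.

Lemma cong_hmor_eq (X Y : hmor_ob A) (a b : hmor_mor X Y) T (x : T ⟶ hX X) :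
  hmor_eq a b -> cong (ha a ∘ x) (ha b ∘ x).
Proof.
move=> [r e]; apply: (cong_im (x' := r ∘ x)).
by rewrite -acompBl e acompA.
Qed.

Lemma cong_inj (X Y : hmor_ob A) (a : hmor_mor X Y) T (x y : T ⟶ hX X) :
  S a -> cong (ha a ∘ x) (ha a ∘ y) -> cong x y.
Proof.
move=> /(S_conflP)[inj _] [T' [q [z [cq]]]].
rewrite -acompBr -acompA => /inj[T'' [r [x' [cr e]]]].
exists T'', (q ∘ r), x'; split; first exact: cover_comp.
by rewrite acompA.
Qed.

Lemma cong_surj (X Y : hmor_ob A) (a : hmor_mor X Y) T (y : T ⟶ hX Y) :
  S a -> exists T' (q : T' ⟶ T) (x : T' ⟶ hX X),
    cover q /\ cong (ha a ∘ x) (y ∘ q).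
Proof.
move=> /(S_conflP)[_ surj].
have [T' [q [x [y' [cq e]]]]] := surj T y.
exists T', q, x; split=> //; apply: cong_sym => //.
by apply: (cong_im (x' := y')); rewrite e addrC addKr.
Qed.

(* Invariant of equality in the localization: a formal fraction is read as a
   relation on generalized elements of the cokernel sheaves. *)
Fixpoint loc_rel X Y (phi : loc_hom S X Y) :
    forall T : A, (T ⟶ hX X) -> (T ⟶ hX Y) -> Prop :=
  match phi with
  | loc_mor _ _ f => fun T x y => cong (ha f ∘ x) y
  | loc_inv _ _ s _ => fun T y x => cong (ha s ∘ x) y
  | loc_comp _ Y _ g f => fun T x z => exists T' (q : T' ⟶ T) (y : T' ⟶ hX Y),
      [/\ cover q, loc_rel f (x ∘ q) y & loc_rel g y (z ∘ q)]
  end.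

(** With the next two lemmas, [loc_rel phi] becomes a subsheaf of the product of the two cokernel
    sheaves. *)
Lemma loc_rel_pre X Y (phi : loc_hom S X Y) T T' (e : T' ⟶ T) x y :
  loc_rel phi x y -> loc_rel phi (x ∘ e) (y ∘ e).
Proof.
elim: phi T T' e x y => {X Y} /= [X Y f|X Y s Ss|X Y Z g IHg f IHf] T T' e x y.
- by move=> /(cong_pre e); rewrite acompA.
- by move=> /(cong_pre e); rewrite acompA.
move=> [U [q [z [cq rf rg]]]]; have [P [v [p [cp ep]]]] := cover_pull e cq.
exists P, p, (z ∘ v); split=> //.
  by rewrite -acompA -ep acompA; apply: IHf.
by rewrite -acompA -ep acompA; apply: IHg.
Qed.

Lemma loc_rel_cong X Y (phi : loc_hom S X Y) T (x x' : T ⟶ hX X)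
    (y y' : T ⟶ hX Y) :
  cong x x' -> cong y y' -> loc_rel phi x y -> loc_rel phi x' y'.
Proof.
elim: phi T x x' y y' => {X Y} /= [X Y f|X Y s Ss|X Y Z g IHg f IHf] T x x' y y' ex ey.
- move=> e; apply: (cong_trans _ ey); apply: (cong_trans _ e).
  exact/cong_map/cong_sym.
- move=> e; apply: (cong_trans _ ex); apply: (cong_trans _ e).
  exact/cong_map/cong_sym.
move=> [U [q [z [cq rf rg]]]]; exists U, q, z; split=> //.
  by apply: IHf rf; [apply: cong_pre|apply: cong_refl].
by apply: IHg rg; [apply: cong_refl|apply: cong_pre].
Qed.

Lemma loc_rel_local X Y (phi : loc_hom S X Y) T T' (q : T' ⟶ T) x y :
  cover q -> loc_rel phi (x ∘ q) (y ∘ q) -> loc_rel phi x y.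
Proof.
case: phi x y => {X Y} /= [X Y f|X Y s Ss|X Y Z g f] x y cq.
- by rewrite acompA; apply: cong_local.
- by rewrite acompA; apply: cong_local.
move=> [U [r [z [cr rf rg]]]]; exists U, (q ∘ r), z.
by rewrite !acompA; split=> //; apply: cover_comp.
Qed.

Lemma loc_rel_comp_id X Y Z (g : loc_hom S Y Z) (f : loc_hom S X Y) T x y z :
  loc_rel f x y -> loc_rel g y z -> @loc_rel _ _ (loc_comp g f) T x z.
Proof.
by move=> rf rg; exists T, (aid T), y; rewrite !acomp1r; split=> //; apply: cover_id.
Qed.

(** Each generating rule is an identity between graphs of sheaf maps. The rule [loc_invl] uses
    injectivity of members of [S], and [loc_invr] their surjectivity. *)
Lemma loc_eq_rel X Y (phi psi : loc_hom S X Y) : loc_eq phi psi ->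
  forall T x y, @loc_rel _ _ phi T x y <-> @loc_rel _ _ psi T x y.
Proof.
elim=> {X Y phi psi}.
- by [].
- by move=> X Y f g _ IH T x y; rewrite IH.
- by move=> X Y f g h _ IH1 _ IH2 T x y; rewrite IH1.
- move=> X Y Z g g' f f' _ IHg _ IHf T x z /=.
  by split=> -[U [q [y [cq rf rg]]]]; exists U, q, y; split=> //;
    [apply/IHf|apply/IHg|apply/IHf|apply/IHg].
- move=> X Y f T x y; split.
    move=> /= [U [q [z [cq rf]]]]; rewrite acomp1l => e.
    by apply: (loc_rel_local cq); apply: loc_rel_cong rf => //; apply: cong_refl.
  move=> r; apply: (loc_rel_comp_id r); rewrite /= acomp1l; exact: cong_refl.
- move=> X Y f T x y; split.
    move=> /= [U [q [z [cq]]]]; rewrite acomp1l => e rf.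
    apply: (loc_rel_local cq); apply: loc_rel_cong rf; last exact: cong_refl.
    exact: cong_sym.
  move=> r; apply: (loc_rel_comp_id _ r); rewrite /= acomp1l; exact: cong_refl.
- move=> X Y Z W h g f T x w; split.
    move=> [U [q [z [cq [V [r [y [cr rf rg]]]] rh]]]].
    exists V, (q ∘ r), y; rewrite !acompA; split=> //; first exact: cover_comp.
    by apply: (loc_rel_comp_id rg); apply: loc_rel_pre.
  move=> [U [q [y [cq rf [V [r [z [cr rg rh]]]]]]]].
  exists V, (q ∘ r), z; rewrite !acompA; split=> //; first exact: cover_comp.
  by apply: (loc_rel_comp_id _ rg); apply: loc_rel_pre.
- move=> X Y f g efg T x y; split=> /= e; apply: (cong_trans _ e).
    exact/cong_sym/cong_hmor_eq.
  exact: cong_hmor_eq.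
- move=> X Y Z g f T x z; split=> [e|[U [q [y [cq /= ef eg]]]]].
    apply: (loc_rel_comp_id (y := ha f ∘ x)); first exact: cong_refl.
    by rewrite /= acompA.
  apply: (cong_local cq) => /=.
  apply: (cong_trans _ eg).
  by rewrite -!acompA; apply: cong_map.
- move=> X Y s Ss T x z; split=> [[U [q [y [cq /= e1 e2]]]]|e].
    rewrite /= acomp1l; apply: (cong_local cq); apply: (cong_inj Ss).
    by apply: (cong_trans e1); apply: cong_sym.
  apply: (loc_rel_comp_id (y := ha s ∘ x)); first exact: cong_refl.
  by rewrite /= acomp1l in e; apply/cong_map/cong_sym.
- move=> X Y s Ss T x z; split=> [[U [q [y [cq /= e1 e2]]]]|e].
    rewrite /= acomp1l; apply: (cong_local cq).
    by apply: (cong_trans _ e2); apply: cong_sym.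
  have [U [q [y [cq ey]]]] := cong_surj x Ss.
  exists U, q, y; split=> //=; apply: (cong_trans ey).
  by apply: cong_pre => //; rewrite /= acomp1l in e.
Qed.

Lemma left_fraction_rel (X Y Z : hMor_ker A) (a : X ~> Z) (s : Y ~> Z)
    (Ss : S s) T x y :
  @loc_rel _ _ (left_fraction Ss a) T x y <-> cong (ha a ∘ x) (ha s ∘ y).
Proof.
split=> [[U [q [z [cq /= e1 e2]]]]|e].
  apply: (cong_local cq); rewrite -!acompA.
  by apply: (cong_trans e1); apply: cong_sym.
apply: (loc_rel_comp_id (y := ha a ∘ x)); first exact: cong_refl.
exact: cong_sym.
Qed.

(** An Ore square gives a common denominator. Equality in the localization then makes the numerators
    agree on cokernel sheaves, and [equalize_left] makes them homotopic after a member of [S].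
    Conversely, both fractions expand to the same one. *)
Lemma left_fraction_eqP (X Y Z1 Z2 : hMor_ker A) (a1 : X ~> Z1) (s1 : Y ~> Z1)
    (Ss1 : S s1) (a2 : X ~> Z2) (s2 : Y ~> Z2) (Ss2 : S s2) :
  loc_eq (left_fraction Ss1 a1) (left_fraction Ss2 a2) <->
  exists W (u1 : Z1 ~> W) (u2 : Z2 ~> W),
    [/\ u1 \c a1 ==~ u2 \c a2, u1 \c s1 ==~ u2 \c s2 & S (u1 \c s1)].
Proof.
have mS := S_confl_multiplicative.
split=> [e|[W [u1 [u2 [ea es Sus]]]]]; last first.
  have Sus2 := ms_respects_eq mS es Sus.
  apply: loc_trans (left_fraction_expand a1 Ss1 Sus) _.
  apply: loc_trans (loc_sym (left_fraction_expand a2 Ss2 Sus2)).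
  exact: left_fraction_eq.
have [W [u2 [u1 [Su1 es]]]] := ms_ore_left mS s1 Ss2.
have [|V [t [St et]]] := @equalize_left X W (u1 \c a1) (u2 \c a2).
  (* Locally [a1] is congruent to [s1] applied to some [y]; the Ore square passes to [s2] applied to
     [y], and [loc_rel] returns to [a2]. *)
  have [T [q [y [cq ey]]]] := cong_surj (ha a1) Ss1.
  apply: (cong_local cq) => /=; rewrite -!acompA.
  apply: (cong_trans (cong_map u1 (cong_sym ey))); rewrite acompA.
  apply: (cong_trans (cong_hmor_eq y es)); rewrite -acompA.
  apply/cong_map/cong_sym/(left_fraction_rel a2 Ss2 q y)/(loc_eq_rel e).
  exact/left_fraction_rel/cong_sym.
exists V, (t \c u1), (t \c u2); split.
- by rewrite -!ccompA; apply: et.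
- by rewrite -!ccompA es.
- by apply: (ms_comp mS) (Ss1); apply: (ms_comp mS).
Qed.

Lemma right_fraction_rel (X Y Z : hMor_ker A) (a : Z ~> Y) (s : Z ~> X)
    (Ss : S s) T (z : T ⟶ hX Z) :
  @loc_rel _ _ (right_fraction a Ss) T (ha s ∘ z) (ha a ∘ z).
Proof. by apply: (loc_rel_comp_id (y := z)); apply: cong_refl. Qed.

Lemma right_fraction_eqP (X Y Z1 Z2 : hMor_ker A) (a1 : Z1 ~> Y) (s1 : Z1 ~> X)
    (Ss1 : S s1) (a2 : Z2 ~> Y) (s2 : Z2 ~> X) (Ss2 : S s2) :
  loc_eq (right_fraction a1 Ss1) (right_fraction a2 Ss2) <->
  exists W (u1 : W ~> Z1) (u2 : W ~> Z2),
    [/\ a1 \c u1 ==~ a2 \c u2, s1 \c u1 ==~ s2 \c u2 & S (s1 \c u1)].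
Proof.
have mS := S_confl_multiplicative.
split=> [e|[W [u1 [u2 [ea es Ssu]]]]]; last first.
  have Ssu2 := ms_respects_eq mS es Ssu.
  apply: loc_trans (right_fraction_expand a1 Ss1 Ssu) _.
  apply: loc_trans (loc_sym (right_fraction_expand a2 Ss2 Ssu2)).
  exact: right_fraction_eq.
have [W [u2 [u1 [Su1 es]]]] := ms_ore_right mS s1 Ss2.
have [|V [t [St et]]] := @equalize_right W Y (a1 \c u1) (a2 \c u2).
  (* The first fraction relates the images of [u1] under [s1] and [a1]. Reading this in the second
     yields a local [z], which injectivity of [s2] identifies with [u2]. *)
  have /(loc_eq_rel e)[T [q [z [cq /= e1 e2]]]] :=
    right_fraction_rel a1 Ss1 (ha u1).
  apply: (cong_local cq) => /=.
  apply: (cong_trans (cong_sym e2)); rewrite -acompA; apply: cong_map.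
  apply: (cong_inj Ss2); apply: (cong_trans e1); rewrite acompA.
  exact: (cong_hmor_eq q es).
exists V, (u1 \c t), (u2 \c t); split.
- by rewrite !ccompA; apply: et.
- by rewrite !ccompA es.
- by apply: (ms_comp mS) (Ss1) _; apply: (ms_comp mS).
Qed.

Lemma S_confl_left_fractions : calculus_of_left_fractions S.
Proof.
split; [exact: left_fraction_repr S_confl_multiplicative|
  exact: left_fraction_eqP|exact: fraction_calculus_comp_left].
Qed.

Lemma S_confl_right_fractions : calculus_of_right_fractions S.
Proof.
split; [exact: right_fraction_repr S_confl_multiplicative|
  exact: right_fraction_eqP|exact: fraction_calculus_comp_right].
Qed.

(** * Complexes and quasi-isomorphisms *)

(** Exactness is in degree [n + 1]: the index is that of the incoming differential, as in
    [conflation_at]. *)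
Definition exact_at (X : complex A) (n : int) : Prop :=
  forall T (y : T ⟶ X (n + 1)), cxd X (n + 1) ∘ y = 0 ->
    exists T' (q : T' ⟶ T) (x : T' ⟶ X n), cover q /\ cxd X n ∘ x = y ∘ q.

(** As [i'] is a monomorphism, [p] and the differential have the same kernel. Exactness at the
    generic cocycle [i'] gives a local section of [p]. *)
Lemma confl_of_exact (X : complex A) n (K K' : A) (i : K ⟶ X n)
    (i' : K' ⟶ X (n + 1)) (p : X n ⟶ K') :
  exact_at X n -> is_kernel i (cxd X n) -> is_kernel i' (cxd X (n + 1)) ->
  i' ∘ p = cxd X n -> CC i p.
Proof.
move=> ex ki ki' e; have mono := is_kernel_mono ki'.
apply: confl_of_kernel.
  apply: is_kernelI; last 2 first.
  - by move=> T u v; apply: (is_kernel_mono ki).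
  - move=> T t pt; have [|u iu] := is_kernel_lift ki (t := t); last by exists u.
    by rewrite -e -acompA pt acomp0r.
  - by apply: mono; rewrite acompA e ki.1 acomp0r.
have [T [q [x [cq ex']]]] := ex _ i' ki'.1.
apply: (cover_of_section (s := x)).
suff -> : p ∘ x = q by [].
by apply: mono; rewrite acompA e.
Qed.

Lemma conflation_atP (X : complex A) n : conflation_at CC X n <-> exact_at X n.
Proof.
split=> [[K [K' [i [i' [p [ki ki' e c]]]]]] T y dy|ex].
  have [u iu] := is_kernel_lift ki' dy.
  have [T' [x [q [cq e']]]] := cover_pull u (confl_cover c).
  by exists T', q, x; split=> //; rewrite -e -acompA e' acompA iu.
have [K [i ki]] := hker (cxd X n); have [K' [i' ki']] := hker (cxd X (n + 1)).
have [p ep] := is_kernel_lift ki' (cxdd X n).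
by exists K, K', i, i', p; split=> //; apply: confl_of_exact ep.
Qed.

Lemma acyclicP (X : complex A) : acyclic CC X <-> forall n, exact_at X n.
Proof.
split=> [[Z [j [p [e c]]]] n T y dy|ex].
  have kj m : is_kernel (j m) (p m) := confl_ker (sde_conflation hCC) (c m).
  (* The next [j] is a monomorphism, so a cocycle is already killed by [p]. *)
  have [|u ju] := is_kernel_lift (kj (n + 1)) (t := y).
    by apply: (is_kernel_mono (kj _)); rewrite acompA -e dy acomp0r.
  have [T' [x [q [cq e']]]] := cover_pull u (confl_cover (c n)).
  by exists T', q, x; split=> //; rewrite e -acompA e' acompA ju.
pose j n := sval (projT2 (hmor_of_mor (cxd X n))).
have kj n : is_kernel (j n) (cxd X n) := svalP (projT2 (hmor_of_mor (cxd X n))).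
pose p n := sval (is_kernel_lift (kj (n + 1)) (cxdd X n)).
have jp n : j (n + 1) ∘ p n = cxd X n := svalP (is_kernel_lift _ (cxdd X n)).
exists (fun n => projT1 (hmor_of_mor (cxd X n))), j, p.
by split=> n; [rewrite jp|apply: confl_of_exact (jp n)].
Qed.

(** Here [(-x, y)] is a cocycle of the mapping cone in degree [n + 1] and [(x', y')] a local
    primitive. This contains injectivity on cohomology in degree [n + 2] and, for [x = 0],
    surjectivity in degree [n + 1]. *)
Definition quasi_iso (X Y : complex A) (f : cochain_map X Y) : Prop :=
  forall n T (x : T ⟶ X (n + 1 + 1)) (y : T ⟶ Y (n + 1)),
    cxd X (n + 1 + 1) ∘ x = 0 -> f (n + 1 + 1) ∘ x = cxd Y (n + 1) ∘ y ->
    exists T' (q : T' ⟶ T) (x' : T' ⟶ X (n + 1)) (y' : T' ⟶ Y n),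
      [/\ cover q, cxd X (n + 1) ∘ x' = x ∘ q
        & f (n + 1) ∘ x' + cxd Y n ∘ y' = y ∘ q].

Lemma acyclic_coneP (X Y : complex A) (f : cochain_map X Y) :
  acyclic_cone CC f <-> quasi_iso f.
Proof.
have coneE n T (x : T ⟶ X (n + 1)) (y : T ⟶ Y n) :
    cxd (mapping_cone f) n ∘ col_mor x y
    = col_mor (- (cxd X (n + 1) ∘ x)) (f (n + 1) ∘ x + cxd Y n ∘ y).
  by rewrite /= /block_mor col_morM !row_col acomp0l addr0 acompNl.
split=> [/acyclicP ex n T x y dx fx|qi].
  have [|T' [q [v [cq]]]] := ex n T (col_mor (- x) y).
    by rewrite coneE !acompNr dx fx addNr !oppr0 col_mor0.
  rewrite [v]col_eta coneE col_morM => /col_mor_inj[e1 e2].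
  exists T', q, (apr1 ∘ v), (apr2 ∘ v); split=> //.
  by apply: oppr_inj; rewrite e1 acompNl.
apply/acyclicP => n T v; rewrite [v]col_eta coneE -col_mor0 => /col_mor_inj[e1 e2].
have [||T' [q [x' [y' [cq ex ey]]]]] := qi n T (- (apr1 ∘ v)) (apr2 ∘ v).
- by rewrite acompNr.
- by apply/eqP; rewrite acompNr eqr_oppLR -addr_eq0 e2.
exists T', q, (col_mor x' y'); split=> //.
by rewrite coneE ex ey acompNl opprK [RHS]col_morM.
Qed.

(** * Truncation and cohomology in degree zero *)

Section Truncation.
Context (X : complex A).

(** Degree 0 is written [Negz 0 + 1], the degree in which [cxd X (Negz 0)] lands; the two are
    convertible. *)
Let ker0 := hmor_of_mor (cxd X (Negz 0 + 1)).

Definition cocycle_in : projT1 ker0 ⟶ X (Negz 0 + 1) := sval (projT2 ker0).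

Lemma cocycle_kernel : is_kernel cocycle_in (cxd X (Negz 0 + 1)).
Proof. exact: (svalP (projT2 ker0)). Qed.

Definition coh_ob : hmor_ob A :=
  hmor_of (sval (is_kernel_lift cocycle_kernel (cxdd X (Negz 0)))).

Lemma cocycle_in_hf : cocycle_in ∘ hf coh_ob = cxd X (Negz 0).
Proof. exact: (svalP (is_kernel_lift cocycle_kernel (cxdd X (Negz 0)))). Qed.

Definition tau_ob (n : int) : A :=
  match n with Posz 0 => hX coh_ob | Posz _ => azero | Negz k => X (Negz k) end.

Definition tau_in (n : int) : tau_ob n ⟶ X n :=
  match n with
  | Posz 0 => cocycle_in
  | Posz _ => 0
  | Negz k => aid (X (Negz k))
  end.

(** Separating [Negz 0] lets [n + 1] compute in each branch, so no transport occurs. *)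
Definition tau_d (n : int) : tau_ob n ⟶ tau_ob (n + 1) :=
  match n with
  | Posz _ => 0
  | Negz 0 => hf coh_ob
  | Negz k.+1 => cxd X (Negz k.+1)
  end.

Lemma tau_zero n : 0 < n -> aid (tau_ob n) = 0.
Proof. by case: n => [[|n]|n] // _; apply: azeroP. Qed.

(** Through this, identities between maps into the truncation are checked in [X]. *)
Lemma tau_in_mono n T (u v : T ⟶ tau_ob n) :
  tau_in n ∘ u = tau_in n ∘ v -> u = v.
Proof.
case: n u v => [[|n]|n] u v /=.
- exact: (is_kernel_mono cocycle_kernel).
- by move=> _; rewrite (zero_to (azeroP _) u) (zero_to (azeroP _) v).
- by rewrite !acomp1l.
Qed.

Lemma tau_lift n T (t : T ⟶ X n) : n < 0 -> {u | tau_in n ∘ u = t}.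
Proof. by case: n t => // n t _; exists t; rewrite /= acomp1l. Qed.

Lemma tau_lift_cocycle n T (t : T ⟶ X n) :
  n <= 0 -> cxd X n ∘ t = 0 -> {u | tau_in n ∘ u = t}.
Proof.
case: n t => [[|n]|n] t // _; first exact: (is_kernel_lift cocycle_kernel).
by move=> _; apply: tau_lift.
Qed.

Lemma tau_in_d n : cxd X n ∘ tau_in n = tau_in (n + 1) ∘ tau_d n.
Proof.
case: n => [[|n]|[|n]] /=.
- by rewrite acomp0r; apply: cocycle_kernel.1.
- by rewrite !acomp0r.
- by rewrite acomp1r; symmetry; apply: cocycle_in_hf.
- by rewrite acomp1r; symmetry; apply: acomp1l.
Qed.

Lemma tau_dd n : tau_d (n + 1) ∘ tau_d n = 0.
Proof.
apply: tau_in_mono; rewrite acompA -tau_in_d -acompA -tau_in_d acompA.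
by rewrite cxdd acomp0l acomp0r.
Qed.

Definition tau : complex A := Complex tau_dd.

Definition tau_inclusion : cochain_map tau X := @CochainMap A tau X tau_in tau_in_d.

End Truncation.

Section TruncationMap.
Context (X Y : complex A) (f : cochain_map X Y).

Lemma cocycle_map :
  {g : hX (coh_ob X) ⟶ hX (coh_ob Y) |
     cocycle_in Y ∘ g = f (Negz 0 + 1) ∘ cocycle_in X}.
Proof.
apply: (is_kernel_lift (cocycle_kernel Y)).
by rewrite acompA cmd -acompA (cocycle_kernel X).1 acomp0r.
Qed.

Lemma coh_map_sig : {b : hmor_mor (coh_ob X) (coh_ob Y) |
  ha' b = f (Negz 0) /\ ha b = sval cocycle_map}.
Proof.
apply: hmor_lift; apply: (is_kernel_mono (cocycle_kernel Y)).
rewrite acompA cocycle_in_hf acompA (svalP cocycle_map) -acompA cocycle_in_hf.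
exact: cmd.
Qed.

Definition coh_map : hmor_mor (coh_ob X) (coh_ob Y) := sval coh_map_sig.

Lemma ha'_coh_map : ha' coh_map = f (Negz 0).
Proof. exact: (svalP coh_map_sig).1. Qed.

Lemma ha_coh_map :
  cocycle_in Y ∘ ha coh_map = f (Negz 0 + 1) ∘ cocycle_in X.
Proof. by rewrite (svalP coh_map_sig).2; apply: (svalP cocycle_map). Qed.

Definition tau_map_at (n : int) : tau_ob X n ⟶ tau_ob Y n :=
  match n with
  | Posz 0 => ha coh_map
  | Posz _ => 0
  | Negz k => f (Negz k)
  end.

Lemma tau_map_in n : tau_in Y n ∘ tau_map_at n = f n ∘ tau_in X n.
Proof.
case: n => [[|n]|n] /=; first exact: ha_coh_map.
  by rewrite !acomp0r.
by rewrite acomp1l acomp1r.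
Qed.

Lemma tau_map_d n :
  tau_d Y n ∘ tau_map_at n = tau_map_at (n + 1) ∘ tau_d X n.
Proof.
apply: tau_in_mono; rewrite !acompA tau_map_in -tau_in_d -!acompA -tau_in_d.
by rewrite tau_map_in !acompA cmd.
Qed.

Definition tau_map : cochain_map (tau X) (tau Y) :=
  @CochainMap A (tau X) (tau Y) tau_map_at tau_map_d.

End TruncationMap.

(** On cocycles the summand of the homotopy formula that starts with a differential vanishes, and
    the other one is a boundary. *)
Lemma coh_map_homotopic (X Y : complex A) (f g : cochain_map X Y) :
  homotopic f g -> hmor_eq (coh_map f) (coh_map g).
Proof.
move=> [h hP]; exists (h (Negz 0) ∘ cocycle_in X).
apply: (is_kernel_mono (cocycle_kernel Y)).
rewrite acompBr !ha_coh_map -acompBl hP acompDl -!acompA (cocycle_kernel X).1.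
by rewrite acomp0r addr0 acompA -(cocycle_in_hf Y) !acompA.
Qed.

Definition coh : functor (homotopy_category A) (hMor_ker A).
Proof.
apply: (@Functor (homotopy_category A) (hMor_ker A) coh_ob coh_map).
- exact: coh_map_homotopic.
- move=> X; apply: eq_hmor; apply: (is_kernel_mono (cocycle_kernel X)).
  by rewrite ha_coh_map /= acomp1l acomp1r.
- move=> X Y Z g f; apply: eq_hmor; apply: (is_kernel_mono (cocycle_kernel Z)).
  by rewrite ha_coh_map /= acompA ha_coh_map -!acompA ha_coh_map.
Defined.

Lemma tau_map_homotopic (X Y : complex A) (f g : cochain_map X Y) :
  homotopic f g -> homotopic (tau_map f) (tau_map g).
Proof.
move=> [h hP].
(* For [n < 0] the target is all of [Y n], so the restricted homotopy lifts. For [n >= 0] the source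
   is a zero object, and 0 is the only choice. *)
have k_sig n : {k : tau_ob X (n + 1) ⟶ tau_ob Y n |
    n < 0 -> tau_in Y n ∘ k = h n ∘ tau_in X (n + 1)}.
  case n0: (n < 0); last by exists 0.
  by have [k kP] := tau_lift (h n ∘ tau_in X (n + 1)) n0; exists k.
have [k kP] : exists k : forall n, tau_ob X (n + 1) ⟶ tau_ob Y n,
    forall n, n < 0 -> tau_in Y n ∘ k n = h n ∘ tau_in X (n + 1).
  by exists (fun n => sval (k_sig n)) => n; apply: (svalP (k_sig n)).
exists k => n.
have [n0|n0] := boolP (n < 0); last first.
  have z : aid (tau_ob X (n + 1)) = 0 by apply: tau_zero; lia.
  by rewrite (zero_from z (tau_map f _ - _)) (zero_from z (_ + _)).
apply: (@tau_in_mono Y); rewrite acompBr !tau_map_in -acompBl hP acompDl acompDr.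
rewrite acompA -tau_in_d -![cxd Y n ∘ _ ∘ _]acompA kP //; congr (_ + _).
(* In the remaining case [n = -1], both second summands factor through the truncation in degree 1,
   which is zero. *)
have [n1|n1] := boolP (n + 1 < 0).
  by rewrite acompA kP // -!acompA tau_in_d.
have z : aid (tau_ob X (n + 1 + 1)) = 0 by apply: tau_zero; lia.
rewrite -[h _ ∘ _ ∘ _]acompA tau_in_d (zero_to z (tau_d _ _)).
by rewrite (zero_to z (cxd (tau X) _)) !acomp0r.
Qed.

Definition tau_functor : functor (homotopy_category A) (homotopy_category A).
Proof.
apply: (@Functor (homotopy_category A) (homotopy_category A) tau tau_map).
- exact: tau_map_homotopic.
- move=> X; apply: eq_homotopic => n; apply: tau_in_mono.
  by rewrite tau_map_in /= acomp1l acomp1r.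
- move=> X Y Z g f; apply: eq_homotopic => n; apply: tau_in_mono.
  by rewrite tau_map_in /= acompA tau_map_in -!acompA tau_map_in.
Defined.

(** The condition [quasi_iso] at [n = -2] gives local injectivity, and at [n = -1] with [x = 0]
    local surjectivity. *)
Lemma coh_quasi_iso (X Y : complex A) (f : cochain_map X Y) :
  acyclic_cone CC f -> S_confl CC (coh_map f).
Proof.
move=> /acyclic_coneP qi; apply/S_conflP; split.
  move=> T x y' e.
  have [||T' [q [x' [_ [cq ex _]]]]] := qi (Negz 1) T (cocycle_in X ∘ x) y'.
  - by rewrite acompA (cocycle_kernel X).1 acomp0l.
  - by rewrite acompA -ha_coh_map -acompA e acompA cocycle_in_hf.
  exists T', q, x'; split=> //; apply: (is_kernel_mono (cocycle_kernel X)).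
  by rewrite !acompA cocycle_in_hf.
move=> T y; have [||T' [q [x' [y' [cq ex ey]]]]] := qi (Negz 0) T 0 (cocycle_in Y ∘ y).
- by rewrite acomp0r.
- by rewrite acomp0r acompA (cocycle_kernel Y).1 acomp0l.
have [|x ex'] := is_kernel_lift (cocycle_kernel X) (t := x').
  by rewrite ex acomp0l.
exists T', q, x, y'; split=> //; apply: (is_kernel_mono (cocycle_kernel Y)).
rewrite acompA -ey acompDr !acompA ha_coh_map.
by rewrite -[_ ∘ cocycle_in X ∘ x]acompA ex' cocycle_in_hf.
Qed.

Lemma tau_quasi_iso (X Y : complex A) (f : cochain_map X Y) :
  acyclic_cone CC f -> acyclic_cone CC (tau_map f).
Proof.
move=> /acyclic_coneP qi; apply/acyclic_coneP => n T x y dx e.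
have [n0|n0] := boolP (n < 0); last first.
  have zx : aid (tau_ob X (n + 1 + 1)) = 0 by apply: tau_zero; lia.
  have zy : aid (tau_ob Y (n + 1)) = 0 by apply: tau_zero; lia.
  exists T, (aid T), 0, 0; rewrite !acomp0r addr0 !acomp1r.
  by split; [exact: cover_id|rewrite (zero_to zx x)|rewrite (zero_to zy y)].
have [||T' [q [x1 [y1 [cq ex ey]]]]] := qi n T (tau_in X _ ∘ x) (tau_in Y _ ∘ y).
- by rewrite acompA tau_in_d -acompA dx acomp0r.
- by rewrite acompA -tau_map_in -acompA e !acompA tau_in_d.
(* When [n + 1 = 0], the differential of [x1] comes from the zero object in degree 1, so [x1] is a
   cocycle and lies in the truncation. *)
have [x' ex'] : {x' | tau_in X (n + 1) ∘ x' = x1}.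
  have [n1|n1] := boolP (n + 1 < 0); first exact: tau_lift.
  apply: tau_lift_cocycle; first by lia.
  have z : aid (tau_ob X (n + 1 + 1)) = 0 by apply: tau_zero; lia.
  by rewrite ex (zero_to z x) acomp0r acomp0l.
have [y' ey'] := tau_lift y1 n0.
exists T', q, x', y'; split=> //; apply: tau_in_mono.
  by rewrite acompA -tau_in_d -acompA ex' ex acompA.
rewrite acompDr !acompA tau_map_in -tau_in_d -!acompA ex' ey' ey.
by rewrite acompA.
Qed.

(** In degrees above 0 exactness supplies primitives. Below, [y] itself lies in the truncation; in
    degree 0 it is a cocycle because [x] vanishes. *)
Lemma tau_inclusion_quasi_iso (X : complex A) :
  (forall n : int, 0 <= n -> exact_at X n) -> acyclic_cone CC (tau_inclusion X).
Proof.
move=> ex; apply/acyclic_coneP => n T x y dx /= e.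
have [n0|n0] := boolP (n < 0); last first.
  have zx : aid (tau_ob X (n + 1 + 1)) = 0 by apply: tau_zero; lia.
  have [||T' [q [y' [cq ey]]]] := ex n _ T y; first by lia.
    by rewrite -e (zero_to zx x) acomp0r.
  exists T', q, 0, y'; rewrite !acomp0r add0r; split=> //.
  by rewrite (zero_to zx x) acomp0l.
have [x' ex'] : {x' | tau_in X (n + 1) ∘ x' = y}.
  have [n1|n1] := boolP (n + 1 < 0); first exact: tau_lift.
  apply: tau_lift_cocycle; first by lia.
  have z : aid (tau_ob X (n + 1 + 1)) = 0 by apply: tau_zero; lia.
  by rewrite -e (zero_to z x) acomp0r.
exists T, (aid T), x', 0; rewrite acomp0r addr0 !acomp1r; split=> //.
  exact: cover_id.
by apply: tau_in_mono; rewrite acompA -tau_in_d -acompA ex'.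
Qed.

(** * Three-term complexes *)

Section ThreeTerm.
Context (X : hmor_ob A).

Definition three_ob (n : int) : A :=
  match n with
  | Posz 0 => hX X
  | Negz 0 => hX' X
  | Negz 1 => hK X
  | _ => azero
  end.

Definition three_d (n : int) : three_ob n ⟶ three_ob (n + 1) :=
  match n with
  | Negz 0 => hf X
  | Negz 1 => hk X
  | _ => 0
  end.

Lemma three_zero n : (0 < n) || (n < - 2) -> aid (three_ob n) = 0.
Proof. by case: n => [[|n]|[|[|n]]] // _; apply: azeroP. Qed.

Lemma three_dd n : three_d (n + 1) ∘ three_d n = 0.
Proof.
case: n => [n|[|[|n]]] /=; rewrite ?acomp0r ?acomp0l //.
exact: (hkP X).1.
Qed.

Definition three : complex A := Complex three_dd.

End ThreeTerm.

Section ThreeTermMap.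
Context (X Y : hmor_ob A).

Definition three_map_at (a : hmor_mor X Y) (n : int) :
    three_ob X n ⟶ three_ob Y n :=
  match n with
  | Posz 0 => ha a
  | Negz 0 => ha' a
  | Negz 1 => ha'' a
  | _ => 0
  end.

Lemma three_map_d (a : hmor_mor X Y) n :
  three_d Y n ∘ three_map_at a n = three_map_at a (n + 1) ∘ three_d X n.
Proof.
case: n => [n|[|[|n]]] /=; rewrite ?acomp0r ?acomp0l //.
  exact: ha_f.
exact: ha_k.
Qed.

Definition three_map (a : hmor_mor X Y) : cochain_map (three X) (three Y) :=
  @CochainMap A (three X) (three Y) (three_map_at a) (three_map_d a).

Lemma three_map_homotopic (a b : hmor_mor X Y) :
  hmor_eq a b -> homotopic (three_map a) (three_map b).
Proof.
move=> [r e].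
(* What [r] leaves of the difference in degree -1 is killed by [hf Y]; its lift [s] is the homotopy
   component from degree -1 to degree -2. *)
have [|s es] := is_kernel_lift (hkP Y) (t := ha' a - ha' b - r ∘ hf X).
  by rewrite !acompBr !ha_f -acompBl e acompA subrr.
exists (fun n => match n return three_ob X (n + 1) ⟶ three_ob Y n with
  Negz 0 => r | Negz 1 => s | _ => 0 end).
case=> [n|[|[|[|n]]]].
- have z : aid (three_ob X (Posz n + 1)) = 0 by apply: three_zero; lia.
  by rewrite (zero_from z (_ - _)) (zero_from z (_ + _)).
- by rewrite /= e acomp0l addr0.
- by rewrite /= es subrK.
- rewrite /= acomp0r add0r; apply: (is_kernel_mono (hkP Y)).
  by rewrite acompBr !ha_k acompA es !acompBl -[r ∘ _ ∘ _]acompA (hkP X).1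
    acomp0r subr0.
- have z : aid (three_ob X (Negz n.+3 + 1)) = 0 by apply: three_zero; lia.
  by rewrite (zero_from z (_ - _)) (zero_from z (_ + _)).
Qed.

End ThreeTermMap.

Definition three_functor : functor (hMor_ker A) (homotopy_category A).
Proof.
apply: (@Functor (hMor_ker A) (homotopy_category A) three three_map).
- exact: three_map_homotopic.
- by move=> X; apply: eq_homotopic; case=> [[|n]|[|[|n]]] //=;
    rewrite (azeroP A).
- by move=> X Y Z g f; apply: eq_homotopic; case=> [[|n]|[|[|n]]] //=;
    rewrite acomp0l.
Defined.

Lemma three_quasi_iso (X Y : hmor_ob A) (s : hmor_mor X Y) :
  S_confl CC s -> acyclic_cone CC (three_map s).
Proof.
move=> /S_conflP[inj surj]; apply/acyclic_coneP => n T x y dx e.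
have trivial_case : x = 0 -> y = 0 ->
    exists T' (q : T' ⟶ T) (x' : T' ⟶ three X (n + 1)) (y' : T' ⟶ three Y n),
    [/\ cover q, cxd (three X) (n + 1) ∘ x' = x ∘ q
      & three_map s (n + 1) ∘ x' + cxd (three Y) n ∘ y' = y ∘ q].
  move=> -> ->; exists T, (aid T), 0, 0; rewrite !acomp0r addr0 !acomp0l.
  by split=> //; apply: cover_id.
have zX m : (0 < m) || (m < - 2) -> forall t : T ⟶ three X m, t = 0.
  by move=> m0; apply: zero_to; apply: three_zero.
have zY m : (0 < m) || (m < - 2) -> forall t : T ⟶ three Y m, t = 0.
  by move=> m0; apply: zero_to; apply: three_zero.
(* The cases -1 and -2 are local surjectivity and injectivity; -3 and -4 hold because [hk] is a
   kernel; elsewhere all objects involved are zero. *)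
case: n => [n|[|[|[|[|n]]]]] in x y dx e trivial_case *.
- by apply: trivial_case; [apply: zX|apply: zY]; lia.
- have [T' [q [x' [y' [cq ey]]]]] := surj T y.
  exists T', q, x', y'; split=> //.
  by rewrite (zX _ _ x) // acomp0l /= acomp0l.
- have [T' [q [x1 [cq ex]]]] := inj T x y e.
  have [|y' ey] := is_kernel_lift (hkP Y) (t := y ∘ q - ha' s ∘ x1).
    rewrite acompBr !acompA ha_f -[ha s ∘ _ ∘ x1]acompA -ex acompA.
    by rewrite -[hf Y ∘ y]e subrr.
  exists T', q, x1, y'; split=> //.
  by transitivity (ha' s ∘ x1 + hk Y ∘ y'); rewrite // ey addrCA subrr addr0.
- have [x1 ex] := is_kernel_lift (hkP X) dx.
  exists T, (aid T), x1, 0; rewrite !acomp1r acomp0r addr0; split=> //.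
    exact: cover_id.
  apply: (is_kernel_mono (hkP Y)); rewrite acompA ha_k -acompA ex.
  exact: e.
- apply: trivial_case; last by apply: zY.
  by apply: (is_kernel_mono (hkP X)); rewrite acomp0r.
- by apply: trivial_case; [apply: zX|apply: zY]; lia.
Qed.

(** The excluded index is exactness in degree 0, where the cohomology is the cokernel sheaf. *)
Lemma three_exact (X : hmor_ob A) n : n != - 1 -> exact_at (three X) n.
Proof.
move=> n1 T y dy.
have trivial_case : y = 0 -> exists T' (q : T' ⟶ T) (x : T' ⟶ three X n),
    cover q /\ cxd (three X) n ∘ x = y ∘ q.
  move=> ->; exists T, (aid T), 0; rewrite acomp0r acomp0l.
  by split=> //; apply: cover_id.
have zX m : (0 < m) || (m < - 2) -> forall t : T ⟶ three X m, t = 0.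
  by move=> m0; apply: zero_to; apply: three_zero.
case: n => [n|[|[|[|n]]]] in n1 y dy trivial_case *.
- by apply: trivial_case; apply: zX; lia.
- by [].
- have [x ex] := is_kernel_lift (hkP X) dy.
  by exists T, (aid T), x; rewrite acomp1r; split=> //; apply: cover_id.
- by apply: trivial_case; apply: (is_kernel_mono (hkP X)); rewrite acomp0r.
- by apply: trivial_case; apply: zX; lia.
Qed.

(** * Comparison of complexes with three-term complexes *)

Section Comparison.
Context (X : complex A).

Lemma boundary_lift :
  {b : X (Negz 1) ⟶ hK (coh_ob X) | hk (coh_ob X) ∘ b = cxd X (Negz 1)}.
Proof.
apply: (is_kernel_lift (hkP (coh_ob X))).
apply: (is_kernel_mono (cocycle_kernel X)).
by rewrite acompA cocycle_in_hf acomp0r; apply: (cxdd X (Negz 1)).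
Qed.

Definition tau_proj_at (n : int) : tau_ob X n ⟶ three_ob (coh_ob X) n :=
  match n with
  | Posz 0 => aid (hX (coh_ob X))
  | Negz 0 => aid (X (Negz 0))
  | Negz 1 => sval boundary_lift
  | _ => 0
  end.

Lemma tau_proj_d n :
  three_d (coh_ob X) n ∘ tau_proj_at n = tau_proj_at (n + 1) ∘ tau_d X n.
Proof.
case: n => [n|[|[|[|n]]]] /=; rewrite ?acomp0r ?acomp0l //.
- by rewrite acomp1r; symmetry; apply: acomp1l.
- by rewrite (svalP boundary_lift); symmetry; apply: acomp1l.
symmetry; apply: (is_kernel_mono (hkP (coh_ob X))).
by rewrite acomp0r acompA (svalP boundary_lift); apply: (cxdd X (Negz 2)).
Qed.

Definition tau_proj : cochain_map (tau X) (three (coh_ob X)) :=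
  @CochainMap A (tau X) (three (coh_ob X)) tau_proj_at tau_proj_d.

Lemma tau_proj_quasi_iso :
  (forall n : int, n <= - 2 -> exact_at X n) -> acyclic_cone CC tau_proj.
Proof.
move=> ex; apply/acyclic_coneP => n T x y dx e.
have zY m T' : (0 < m) || (m < - 2) ->
    forall t : T' ⟶ three (coh_ob X) m, t = 0.
  by move=> m0; apply: zero_to; apply: three_zero.
(* Far to the left the target vanishes, and only exactness of [X] is needed. *)
have [n3|n3] := boolP (n + 1 < - 2).
  have [||T' [q [x1 [cq ex1]]]] := ex (n + 1) _ T (tau_in X _ ∘ x).
  - by lia.
  - by rewrite acompA tau_in_d -acompA dx acomp0r.
  have [|x' ex'] := tau_lift x1; first by lia.
  exists T', q, x', 0; split=> //; last first.
    by rewrite [LHS]zY ?n3 ?orbT // [RHS]zY ?n3 ?orbT.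
  by apply: tau_in_mono; rewrite acompA -tau_in_d -acompA ex' ex1 acompA.
have zX m : 0 < m -> forall t : T ⟶ tau X m, t = 0.
  by move=> m0; apply: zero_to; apply: tau_zero.
case: n => [n|[|[|[|n]]]] in x y dx e n3 *.
- have x0 : x = 0 by apply: zX; lia.
  have y0 : y = 0 by apply: zY; lia.
  exists T, (aid T), 0, 0; rewrite x0 y0 !acomp0r addr0 !acomp0l.
  by split=> //; apply: cover_id.
(* For [n = -1] and [n = -2] the projection is the identity in degree [n + 1], so [y] is its own
   preimage. *)
- exists T, (aid T), y, 0; rewrite acomp0r addr0 !acomp1r.
  split; [exact: cover_id| |exact: acomp1l].
  by rewrite (zX _ _ x) //= acomp0l.
- exists T, (aid T), y, 0; rewrite acomp0r addr0 !acomp1r.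
  split; [exact: cover_id| |exact: acomp1l].
  by rewrite -[RHS]acomp1l [RHS]e.
(* For [n = -3], [y] is a cocycle of degree -1 seen in [hK], and exactness of [X] there makes it
   locally a boundary. *)
- have dk : cxd X (Negz 0) ∘ hk (coh_ob X) = 0.
    by rewrite -cocycle_in_hf -acompA (hkP (coh_ob X)).1 acomp0r.
  have [||T' [q [x1 [cq ex1]]]] := ex (Negz 1) _ T (hk (coh_ob X) ∘ y).
  + by [].
  + by rewrite -[RHS](acomp0l _ y) -dk acompA.
  exists T', q, x1, 0; rewrite acomp0r addr0; split=> //.
    rewrite [LHS]ex1; congr (_ ∘ q); symmetry.
    by rewrite -[LHS]acomp1l [LHS]e.
  apply: (is_kernel_mono (hkP (coh_ob X))).
  by rewrite acompA (svalP boundary_lift) ex1 acompA.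
- by [].
Qed.

End Comparison.

Lemma coh_three_sig (X : hmor_ob A) : {e : hmor_mor (coh_ob (three X)) X |
  ha' e = aid (hX' X) /\ ha e = cocycle_in (three X)}.
Proof. by apply: hmor_lift; rewrite acomp1r (cocycle_in_hf (three X)). Qed.

(** The cocycles of [three X] in degree 0 form a kernel of the zero map out of [hX X], so this
    changes [X] only by an isomorphic choice. *)
Definition coh_three (X : hmor_ob A) : hmor_mor (coh_ob (three X)) X :=
  sval (coh_three_sig X).

Lemma ha_coh_three (X : hmor_ob A) :
  ha (coh_three X) = cocycle_in (three X).
Proof. exact: (svalP (coh_three_sig X)).2. Qed.

Lemma coh_three_S_confl (X : hmor_ob A) : S_confl CC (coh_three X).
Proof.
apply/S_conflP; split=> [T x y'|T y].
  rewrite ha_coh_three => e; exists T, (aid T), y'; split; first exact: cover_id.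
  apply: (is_kernel_mono (cocycle_kernel (three X))).
  by rewrite acomp1r acompA (cocycle_in_hf (three X)).
have [|x ex] := is_kernel_lift (cocycle_kernel (three X)) (t := y).
  exact: acomp0l.
exists T, (aid T), x, 0; rewrite acomp0r addr0 acomp1r ha_coh_three.
by split=> //; apply: cover_id.
Qed.

Lemma coh_three_natural (X Y : hmor_ob A) (a : hmor_mor X Y) :
  hmor_eq (hmor_comp (coh_three Y) (coh_map (three_map a)))
          (hmor_comp a (coh_three X)).
Proof.
apply: eq_hmor; rewrite [LHS]/= [RHS]/= !ha_coh_three.
exact: (ha_coh_map (three_map a)).
Qed.

Lemma tau_inclusion_natural (X Y : complex A) (f : cochain_map X Y) :
  homotopic (cochain_comp (tau_inclusion Y) (tau_map f))
            (cochain_comp f (tau_inclusion X)).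
Proof. by apply: eq_homotopic => n; apply: tau_map_in. Qed.

Lemma tau_proj_natural (X Y : complex A) (f : cochain_map X Y) :
  homotopic (cochain_comp (tau_proj Y) (tau_map f))
            (cochain_comp (three_map (coh_map f)) (tau_proj X)).
Proof.
apply: eq_homotopic => -[[|n]|[|[|n]]] /=; rewrite ?acomp0l //.
- by rewrite acomp1l acomp1r.
- by rewrite ha'_coh_map acomp1l acomp1r.
apply: (is_kernel_mono (hkP (coh_ob Y))).
rewrite acompA (svalP (boundary_lift Y)) acompA (ha_k (coh_map f)) ha'_coh_map.
by rewrite -acompA (svalP (boundary_lift X)); apply: (cmd f (Negz 1)).
Qed.

(** * The equivalence *)

Let D := derived_category CC.
Let L := localization S.

Definition coh_L : functor D L := lift_functor (F := coh) coh_quasi_iso.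
Definition three_D : functor L D :=
  lift_functor (F := three_functor) three_quasi_iso.
Definition tau_D : functor D D :=
  lift_functor (F := tau_functor) tau_quasi_iso.

Lemma loc_square (C : category) (S' : mor_class C) (X Y Y' Z : C)
    (g : Y ~> Z) (f : X ~> Y) (g' : Y' ~> Z) (f' : X ~> Y') :
  g \c f ==~ g' \c f' ->
  loc_eq (loc_comp (loc_mor S' g) (loc_mor S' f))
         (loc_comp (loc_mor S' g') (loc_mor S' f')).
Proof. by move=> e; rewrite -!loc_mor_comp; apply: loc_mor_eq. Qed.

Definition tau_inclusion_D (X : D) : tau_D X ~> X :=
  @loc_mor (homotopy_category A) (acyclic_cone CC) (tau X) X (tau_inclusion X).

Definition tau_proj_D (X : D) : tau_D X ~> three_D (coh_L X) :=
  @loc_mor (homotopy_category A) (acyclic_cone CC) (tau X) (three (coh_ob X))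
    (tau_proj X).

Definition coh_three_L (X : L) : coh_L (three_D X) ~> X :=
  @loc_mor (hMor_ker A) S (coh_ob (three X)) X (coh_three X).

Lemma tau_inclusion_D_natural (X Y : D) (phi : X ~> Y) :
  tau_inclusion_D Y \c fmap tau_D phi ==~ phi \c tau_inclusion_D X.
Proof.
apply: (natural_on_localization (P := tau_D) (Q := id_functor D))
  => {phi} {}X {}Y f.
exact/loc_square/tau_inclusion_natural.
Qed.

Lemma tau_proj_D_natural (X Y : D) (phi : X ~> Y) :
  tau_proj_D Y \c fmap tau_D phi
  ==~ fmap three_D (fmap coh_L phi) \c tau_proj_D X.
Proof.
apply: (natural_on_localization (P := tau_D) (Q := comp_functor three_D coh_L))
  => {phi} {}X {}Y f.
exact/loc_square/tau_proj_natural.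
Qed.

Lemma coh_three_L_natural (X Y : L) (phi : X ~> Y) :
  coh_three_L Y \c fmap coh_L (fmap three_D phi) ==~ phi \c coh_three_L X.
Proof.
apply: (natural_on_localization (P := comp_functor coh_L three_D)
  (Q := id_functor L)) => {phi} {}X {}Y f.
exact/loc_square/coh_three_natural.
Qed.

Lemma three_heart (X : hmor_ob A) :
  DL_le0 (CC := CC) (three X) /\ DL_ge0 (CC := CC) (three X).
Proof. by split=> n n1; apply/conflation_atP/three_exact; lia. Qed.

Lemma heart_exact_nonneg (X : left_heart CC) n : 0 <= n -> exact_at (sval X) n.
Proof.
(* The heart conditions at [m] concern position [m - 1], hence the shift. *)
move=> n0; have /conflation_atP := (svalP X).1 (n + 1) ltac:(lia).
by rewrite addrK.
Qed.

Lemma heart_exact_neg (X : left_heart CC) n : n <= - 2 -> exact_at (sval X) n.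
Proof.
move=> n0; have /conflation_atP := (svalP X).2 (n + 1) ltac:(lia).
by rewrite addrK.
Qed.

Definition heart_to_L : functor (left_heart CC) L :=
  @Functor (left_heart CC) L (fun X => coh_ob (sval X))
    (fun X Y phi => fmap coh_L phi) (fun X Y => @fmap_eq _ _ coh_L (sval X) (sval Y))
    (fun X => fmap1 coh_L (sval X)) (fun X Y Z g f => fmapM coh_L g f).

Definition L_to_heart : functor L (left_heart CC) :=
  @Functor L (left_heart CC) (fun X => exist _ (three X) (three_heart X))
    (fun X Y phi => fmap three_D phi) (fun X Y => @fmap_eq _ _ three_D X Y)
    (fun X => fmap1 three_D X) (fun X Y Z g f => fmapM three_D g f).

Lemma left_heart_equivalence : equivalence_of_categories (left_heart CC) L.
Proof.
pose i (X : left_heart CC) := tau_inclusion_D (sval X).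
pose i' (X : left_heart CC) : sval X ~> tau_D (sval X) :=
  loc_inv (tau_inclusion_quasi_iso (@heart_exact_nonneg X)).
pose p (X : left_heart CC) := tau_proj_D (sval X).
pose p' (X : left_heart CC) : three_D (coh_L (sval X)) ~> tau_D (sval X) :=
  loc_inv (tau_proj_quasi_iso (@heart_exact_neg X)).
have i'i X : i' X \c i X ==~ cid _ := loc_invl _.
have ii' X : i X \c i' X ==~ cid _ := loc_invr _.
have p'p X : p' X \c p X ==~ cid _ := loc_invl _.
have pp' X : p X \c p' X ==~ cid _ := loc_invr _.
(* The unit is the zigzag through the truncation; [i] and [p] become invertible by the exactness
   available on the heart. *)
exists heart_to_L, L_to_heart, (fun X => p X \c i' X), (fun X => i X \c p' X),
  coh_three_L, (fun Y => loc_inv (coh_three_S_confl Y)).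
split.
- move=> X X' f.
  have nat_i := tau_inclusion_D_natural (f : sval X ~> sval X').
  have nat_p := tau_proj_D_natural (f : sval X ~> sval X').
  change (fmap three_D (fmap coh_L (f : sval X ~> sval X')) \c (p X \c i' X)
          ==~ p X' \c i' X' \c (f : sval X ~> sval X')).
  (* Naturality of [i'] follows from that of [i] by conjugation. *)
  have e : fmap tau_D (f : sval X ~> sval X') \c i' X
           ==~ i' X' \c (f : sval X ~> sval X').
    by rewrite -[X in X ==~ _]ccomp1l -(i'i X') -ccompA [_ \c (_ \c i' X)]ccompA
      nat_i -ccompA ii' ccomp1r.
  by rewrite ccompA -nat_p -ccompA e ccompA.
- by move=> Y Y' g; apply/ceq_sym/coh_three_L_natural.
- move=> X; split.
  + change (i X \c p' X \c (p X \c i' X) ==~ cid (sval X)).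
    by rewrite -ccompA [p' X \c _]ccompA p'p ccomp1l ii'.
  + change (p X \c i' X \c (i X \c p' X) ==~ cid (three_D (coh_L (sval X)))).
    by rewrite -ccompA [i' X \c _]ccompA i'i ccomp1l pp'.
- by move=> Y; split; [apply: loc_invl|apply: loc_invr].
Qed.

End DeflationTopology.

Theorem theorem3p2 (A : additive_category) (CC : pair_class A)
    (hCC : strongly_deflation_exact CC) (hker : has_kernels A) :
  [/\ equivalence_of_categories (left_heart CC) (localization (S_confl CC)),
      multiplicative_system (S_confl CC),
      saturated (S_confl CC),
      calculus_of_left_fractions (S_confl CC)
    & calculus_of_right_fractions (S_confl CC)].
Proof.
split.
- exact: left_heart_equivalence.
- exact: S_confl_multiplicative.
- exact: S_confl_saturated.
- exact: S_confl_left_fractions.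
- exact: S_confl_right_fractions.
Qed.
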